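(* For every $t\ge0$, the rhmsp $X$ is $H(t)$-localizable at $t$ with local version $Z^{H(t)}$, i.e. $$\Big\{\delta^{-H(t)}\big(X(t+\delta u)-X(t)\big),\ u\ge0\Big\}\longrightarrow\{Z^{H(t)}(u),\ u\ge0\},\quad\delta\to0+,$$ in the sense of convergence of finite-dimensional distributions.
   Context: Fix $\alpha\in(1,2)$. $M$ is an independently scattered rotationally invariant complex S$\alpha$S random measure on $\mathbb R$ with Lebesgue control measure: for every Borel $A$ and $\theta\in\mathbb R$, $e^{i\theta}M(A)\overset{d}{=}M(A)$, $\mathbb E e^{iu\,\mathrm{Re} M(A)}=e^{-\lambda(A)|u|^\alpha}$; values on disjoint Borel subsets of $[0,\infty)$ are independent; $M(-A)=\overline{M(A)}$. For $f$ with $f(-x)=\overline{f(x)}$, $f\in L^\alpha(\mathbb R)$, $\int f\,dM$ is real S$\alpha$S with $\mathbb E\exp(iu\int f dM)=\exp(-|u|^\alpha\|f\|^\alpha_{L^\alpha})$. For $H\in(0,1)$, $Z^H(u)=\int_{\mathbb R}\frac{e^{iux}-1}{|x|^{1/\alpha+H}}M(dx)$. The Hurst function $H:[0,\infty)\to\mathbb R$ satisfies $0<\hat H:=\inf H\le\sup H=:\check H<1$ and $|H(t)-H(s)|\le C|t-s|^\gamma$ for some $C>0$, $\gamma>\check H$ and all $t,s\ge0$. The rhmsp is $X(t)=\int_{\mathbb R}\frac{e^{itx}-1}{|x|^{1/\alpha+H(t)}}M(dx)$, $t\ge0$. *)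

(* Defs.v *)
From HB Require Import structures.
From mathcomp Require Import all_boot all_order all_algebra.
From mathcomp Require Import all_classical all_reals all_analysis.
Set Implicit Arguments. Unset Strict Implicit. Unset Printing Implicit Defensive.
Import Order.TTheory GRing.Theory Num.Theory.
Import numFieldNormedType.Exports.
Local Open Scope classical_set_scope.
Local Open Scope ring_scope.

(* Complex-valued integrands on R are represented as pairs (Re f, Im f). *)
Definition cmod {R : realType} (f : R -> R * R) (x : R) : R :=
  Num.sqrt ((f x).1 ^+ 2 + (f x).2 ^+ 2).

Definition hermitian {R : realType} (f : R -> R * R) : Prop :=
  forall x, (f (- x)).1 = (f x).1 /\ (f (- x)).2 = - (f x).2.

Definition Lalpha_pow {R : realType} (alpha : R) (f : R -> R * R) : \bar R :=
  (\int[@lebesgue_measure R]_x ((cmod f x) `^ alpha)%:E)%E.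

Definition admissible {R : realType} (alpha : R) (f : R -> R * R) : Prop :=
  [/\ hermitian f,
      measurable_fun [set: R] (fun x => (f x).1),
      measurable_fun [set: R] (fun x => (f x).2) &
      (Lalpha_pow alpha f < +oo)%E].

Definition lincomb {R : realType} (a b : R) (f g : R -> R * R) : R -> R * R :=
  fun x => (a * (f x).1 + b * (g x).1, a * (f x).2 + b * (g x).2).

(* Abstract stochastic integral f |-> int f dM w.r.t. a rotationally invariant
   complex SaS random measure with Lebesgue control measure: a.s. linear, and
   int f dM is real SaS with E exp(iu int f dM) = exp(-|u|^alpha ||f||^alpha). *)
Definition SaS_integral {R : realType} (alpha : R) {d : measure_display}
  {Omega : measurableType d} (P : probability Omega R)
  (I : (R -> R * R) -> Omega -> R) : Prop :=
  [/\ (forall f, admissible alpha f -> measurable_fun [set: Omega] (I f)),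
      (forall f g (a b : R), admissible alpha f -> admissible alpha g ->
         {ae P, forall w, I (lincomb a b f g) w = a * I f w + b * I g w}) &
      (forall f, admissible alpha f -> forall u : R,
         (\int[P]_w (cos (u * I f w))%:E =
            (expR (- (`|u| `^ alpha * fine (Lalpha_pow alpha f))))%:E)%E /\
         (\int[P]_w (sin (u * I f w))%:E = 0%:E)%E)].

(* the kernel (e^{isx} - 1) / |x|^{1/alpha + H}, as (Re, Im); value 0 at x = 0
   (a Lebesgue-null set) *)
Definition kern {R : realType} (alpha H s : R) : R -> R * R :=
  fun x => if x == 0 then (0, 0) else
    ((cos (s * x) - 1) / `|x| `^ (alpha^-1 + H),
      sin (s * x) / `|x| `^ (alpha^-1 + H)).

Definition rhmsp {R : realType} (alpha : R) (H : R -> R) {Omega : Type}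
  (I : (R -> R * R) -> Omega -> R) (s : R) : Omega -> R :=
  I (kern alpha (H s) s).

Definition Zproc {R : realType} (alpha h : R) {Omega : Type}
  (I : (R -> R * R) -> Omega -> R) (u : R) : Omega -> R :=
  I (kern alpha h u).

Definition fdd_cvg_0plus {R : realType} {d : measure_display}
  {Omega : measurableType d} (P : probability Omega R)
  (Y : R -> R -> Omega -> R) (Z : R -> Omega -> R) : Prop :=
  forall (n : nat) (us : 'I_n -> R), (forall j, 0 <= us j) ->
  forall phi : 'rV[R]_n -> R, continuous phi ->
  (exists M : R, forall v, `|phi v| <= M) ->
  ((fun delta => \int[P]_w (phi (\row_j Y delta (us j) w))%:E) @ 0^'+ -->
     \int[P]_w (phi (\row_j Z (us j) w))%:E)%E.

Definition localizable_at {R : realType} {d : measure_display}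
  {Omega : measurableType d} (P : probability Omega R)
  (X : R -> Omega -> R) (h t : R) (Z : R -> Omega -> R) : Prop :=
  fdd_cvg_0plus P (fun delta u w => delta `^ (- h) * (X (t + delta * u) w - X t w)) Z.

(* Main.v *)
Require Import Defs.
From HB Require Import structures.
From mathcomp Require Import all_boot all_order all_algebra.
From mathcomp Require Import all_classical all_reals all_analysis.
From mathcomp Require Import measurable_realfun ring lra.
Set Implicit Arguments. Unset Strict Implicit. Unset Printing Implicit Defensive.
Import Order.TTheory GRing.Theory Num.Theory.
Import numFieldNormedType.Exports.
Local Open Scope classical_set_scope.
Local Open Scope ring_scope.

(** Write [h = H t] and [s = t + e u]. The rescaled increment of [X] is the sum
   of the integrals of
     [e ^ - h (kern h s - kern h t)]  and  [e ^ - h (kern (H s) s - kern h s)].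
   After the dilation [x -> x / e], every linear combination of the first kernels
   is, up to a factor of modulus one, the same combination of the [kern h u];
   its L^alpha norm is therefore that of the combination for [Z], so that the
   first parts have exactly the finite-dimensional laws of [Z], for every [e].
   The L^alpha norm of the second kernel is
   O(e ^ - h |H s - h|) = O(e ^ (gamma - h)), hence the second part tends to 0
   in probability. Slutsky's lemma concludes.

   Equality of joint characteristic functions is turned into equality of laws by
   writing a bounded continuous function as an iterated bounded pointwise limit of
   trigonometric polynomials, so that dominated convergence suffices. *)

(** * Elementary trigonometry *)

(** The mean value theorem on [0, x], and oddness for negative [x]. Keeping the intermediate point
    [c] serves both |sin x| <= |x| and a cubic bound on sin x - x. *)
Lemma sin_segment {R : realType} (x : R) : exists2 c, `|c| <= `|x| & sin x = cos c * x.
Proof.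
wlog x0 : x / 0 <= x => [hw|].
  have [/hw//|/ltW x0] := leP 0 x.
  have /hw[c cx sx] : 0 <= - x by rewrite oppr_ge0.
  exists c; first by rewrite -(normrN x).
  by apply: oppr_inj; rewrite -sinN sx mulrN.
have cs : {within `[0, x], continuous (@sin R)}.
  by apply: continuous_subspaceT; exact: continuous_sin.
have [c /[!in_itv]/= /andP[c0 cx] E] := MVT_segment x0 (fun y _ => is_derive_sin y) cs.
by exists c; [rewrite !ger0_norm|move: E; rewrite sin0 !subr0].
Qed.

Lemma sin_norm_le {R : realType} (x : R) : `|sin x| <= `|x|.
Proof.
by have [c _ ->] := sin_segment x; rewrite normrM ler_piMl// cos_max.
Qed.

Lemma onem_cosE {R : realType} (x : R) : 1 - cos x = 2 * sin (x / 2) ^+ 2.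
Proof.
have -> : cos x = cos ((x / 2) *+ 2) by congr cos; rewrite mulr2n; field.
by rewrite cos_mulr2n cos2sin2 mulr2n; ring.
Qed.

Lemma onem_cos_le {R : realType} (x : R) : 1 - cos x <= x ^+ 2 / 2.
Proof.
rewrite onem_cosE.
have : `|sin (x / 2)| ^+ 2 <= `|x / 2| ^+ 2.
  by rewrite lerXn2r ?nnegrE//; exact: sin_norm_le.
by rewrite !real_normK ?num_real// => h; rewrite exprMn in h; lra.
Qed.

(** The bound |sin x - x| <= |x|^3 at x = a / L, with L = k + 1, leaves after multiplication by L an
    error of at most |a|^3 / L. *)
Lemma sin_cvg_id {R : realType} (a : R) :
  k.+1%:R * sin (k.+1%:R^-1 * a) @[k --> \oo] --> a.
Proof.
(* Here sin x - x = (cos c - 1) x with |c| <= |x|, and 1 - cos c <= c^2 / 2. *)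
have B (x : R) : `|sin x - x| <= `|x| ^+ 3.
  have [c cx ->] := sin_segment x.
  rewrite -[X in _ - X]mul1r -mulrBl normrM exprSr ler_wpM2r// distrC.
  rewrite ger0_norm ?subr_ge0 ?cos_le1// (le_trans (onem_cos_le _))//.
  have : `|c| ^+ 2 <= `|x| ^+ 2 by rewrite lerXn2r ?nnegrE.
  by rewrite real_normK ?num_real//; have := sqr_ge0 c; lra.
apply/cvgrPdist_le => /= e e0; near=> k.
pose L : R := k.+1%:R.
have L0 : 0 < L by rewrite ltr0n.
have L1 : 1 <= L by rewrite ler1n.
rewrite -/L distrC (_ : _ - a = L * (sin (L^-1 * a) - L^-1 * a)); last first.
  by rewrite mulrBr mulVKf// gt_eqF.
rewrite normrM gtr0_norm//.
apply: (@le_trans _ _ (L * `|L^-1 * a| ^+ 3)); first by rewrite ler_pM2l.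
rewrite normrM gtr0_norm ?invr_gt0// exprMn.
rewrite (_ : _ * _ = L^-1 * (L^-1 * `|a| ^+ 3)); last first.
  by field; rewrite gt_eqF.
rewrite ler_pdivrMl//.
apply: (@le_trans _ _ (`|a| ^+ 3)).
  by rewrite ler_piMl ?exprn_ge0// invf_le1.
rewrite -ler_pdivrMr//.
apply: (@le_trans _ _ k%:R); last by rewrite ler_nat.
by near: k; exact: nbhs_infty_ger.
Unshelve. all: by end_near. Qed.

(** * Equality in law from characteristic functions *)

Lemma measurable_cos {R : realType} : measurable_fun [set: R] (@cos R).
Proof. by apply: continuous_measurable_fun; exact: continuous_cos. Qed.

Lemma measurable_sin {R : realType} : measurable_fun [set: R] (@sin R).
Proof. by apply: continuous_measurable_fun; exact: continuous_sin. Qed.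

(** * Expectations of bounded random variables *)

Section BoundedIntegrals.
Context {R : realType} {d : measure_display} {Omega : measurableType d}.
Variable P : probability Omega R.

Lemma bounded_integrable (f : Omega -> R) (M : R) :
  measurable_fun setT f -> (forall w, `|f w| <= M) ->
  P.-integrable setT (EFin \o f).
Proof.
move=> mf fM; apply: measurable_bounded_integrable => //.
  by rewrite [X in (X < _)%E]probability_setT ltry.
exists M; split; first exact: num_real.
by move=> x Mx w _; exact: le_trans (fM w) (ltW Mx).
Qed.

Lemma bounded_integralE (f : Omega -> R) (M : R) :
  measurable_fun setT f -> (forall w, `|f w| <= M) ->
  (\int[P]_w (f w)%:E)%E = (\int[P]_w f w)%:E.
Proof.
move=> mf fM; rewrite /Rintegral fineK//; apply: integrable_fin_num => //.
exact: bounded_integrable mf fM.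
Qed.

(** Dominated convergence with a constant bound. Measurability of the limit is part of the
    conclusion, since a continuous function of a random vector is later shown to be measurable as
    such a limit. *)
Lemma bounded_cvg_Rintegral (f_ : nat -> Omega -> R) (f : Omega -> R) (M : R) :
  (forall n, measurable_fun setT (f_ n)) -> (forall n w, `|f_ n w| <= M) ->
  (forall w, f_ ^~ w @ \oo --> f w) ->
  measurable_fun setT f /\
  ((\int[P]_w f_ n w) @[n --> \oo] --> \int[P]_w f w).
Proof.
move=> mf_ f_M f_f.
have mf : measurable_fun setT f.
  by apply: (measurable_fun_cvg mf_) => w _; exact: f_f.
split => //.
have fM w : `|f w| <= M.
  apply: (ler_cvg_to (cvg_norm (f_f w)) (cvg_cst M)).
  by apply: nearW => n; exact: f_M.
have [] := @dominated_convergence _ _ R P setT measurableT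
  (fun n => EFin \o f_ n) (EFin \o f) (EFin \o cst M).
- by move=> n; exact/measurable_EFinP.
- exact/measurable_EFinP.
- by apply: aeW => w _; apply: cvg_EFin; [exact: nearW|exact: f_f].
- by apply: (@bounded_integrable _ `|M|) => //.
- by apply: aeW => w n _ /=; rewrite lee_fin.
move=> _ _ cv.
apply: fine_cvg; move: cv.
by rewrite (bounded_integralE mf fM).
Qed.

End BoundedIntegrals.

(** * Multivariate Bernstein polynomials as expectations over coin tosses *)

Section Bernstein.
Context {R : realType} {n : nat}.
Implicit Types (p x : 'I_n -> R) (G : ('I_n -> R) -> R) (l : seq 'I_n).

(* Expectation of [G] at the end of the walk that starts at [x] and, for each
   [j] in [l] in turn, moves by [s] in direction [j] with probability [p j]. *)
Fixpoint coin_walk l p (s : R) G x : R :=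
  if l is j :: l' then
    p j * coin_walk l' p s G (fun i => x i + (i == j)%:R * s) +
    (1 - p j) * coin_walk l' p s G x
  else G x.

Lemma coin_walk_le l p s G1 G2 x : (forall i, 0 <= p i <= 1) ->
  (forall y, G1 y <= G2 y) -> coin_walk l p s G1 x <= coin_walk l p s G2 x.
Proof.
move=> p01 G12; elim: l x => [|j l IH] x //=.
have /andP[p0 p1] := p01 j.
by apply: lerD; apply: ler_wpM2l => //; rewrite subr_ge0.
Qed.

(** Coordinate [i] ends at [x i] plus [s] times a binomial variable, so its second moment about
    [c i] is the squared bias plus the variance. *)
Lemma coin_walk_quadratic l p s (a b : R) (c : 'I_n -> R) x :
  coin_walk l p s (fun y => a + b * \sum_i (y i - c i) ^+ 2) x =
  a + b * \sum_i ((x i + (count_mem i l)%:R * s * p i - c i) ^+ 2 +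
                  (count_mem i l)%:R * s ^+ 2 * (p i * (1 - p i))).
Proof.
elim: l x => [|j l IH] x /=.
  by congr (_ + _ * _); apply: eq_bigr => i _; rewrite !mul0r !addr0.
rewrite !IH !mulrDr !mulrA (mulrC (p j) b) (mulrC (1 - p j) b) -!mulrA.
rewrite addrACA -mulrDl (addrC (p j)) subrK mul1r; congr (_ + _).
rewrite -mulrDr; congr (_ * _).
rewrite !mulr_sumr -big_split /=; apply: eq_bigr => i _.
have [->|ij] := eqVneq i j.
  by rewrite /= natrD; ring.
by rewrite /= add0n mulr0n; ring.
Qed.

Definition rounds (N : nat) : seq 'I_n := flatten (nseq N (enum 'I_n)).

Lemma count_rounds N i : count_mem i (rounds N) = N.
Proof.
elim: N => [|N IH] //=.
rewrite /rounds /= count_cat -/(rounds N) IH count_uniq_mem ?enum_uniq//.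
by rewrite mem_enum.
Qed.

(** The multivariate Bernstein polynomial of degree [N] in each variable: [G] is averaged over the
    empirical frequencies of [N] tosses of each coin. *)
Definition bernstein (N : nat) G p : R :=
  coin_walk (rounds N) p N%:R^-1 G (fun=> 0).

Lemma bernstein_le N G1 G2 p : (forall i, 0 <= p i <= 1) ->
  (forall y, G1 y <= G2 y) -> bernstein N G1 p <= bernstein N G2 p.
Proof. by move=> p01 G12; exact: coin_walk_le. Qed.

(** The frequencies have mean [p], so only the variance, of order 1 / N, remains. *)
Lemma bernstein_quadratic N (a b : R) p : (0 < N)%N ->
  bernstein N (fun y => a + b * \sum_i (y i - p i) ^+ 2) p =
  a + b * (N%:R^-1 * \sum_i p i * (1 - p i)).
Proof.
move=> N0; rewrite /bernstein coin_walk_quadratic; congr (_ + _ * _).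
rewrite mulr_sumr; apply: eq_bigr => i _; rewrite count_rounds.
have : N%:R != 0 :> R by rewrite pnatr_eq0 -lt0n.
by move=> ?; field.
Qed.

Lemma bernstein_norm N G (M : R) p : (forall i, 0 <= p i <= 1) ->
  (forall y, `|G y| <= M) -> `|bernstein N G p| <= M.
Proof.
move=> p01 GM.
(* A constant is the quadratic function with [b = 0]. *)
have cstE c : bernstein N (fun=> c) p = c.
  have -> : (fun=> c) = (fun y : 'I_n -> R => c + 0 * \sum_i (y i - 0) ^+ 2).
    by apply/funext => y; rewrite mul0r addr0.
  by rewrite /bernstein (coin_walk_quadratic _ _ _ _ _ (fun=> 0)) mul0r addr0.
rewrite ler_norml; apply/andP; split.
  rewrite -[leLHS]cstE; apply: bernstein_le => // y.
  by have := GM y; rewrite ler_norml => /andP[].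
rewrite -[leRHS]cstE; apply: bernstein_le => // y.
by have := GM y; rewrite ler_norml => /andP[].
Qed.

(** Bernstein's argument by Chebyshev's inequality: with K = 2M / h^2, |G y - G p| is at most e / 2
    + K |y - p|^2, because either [y] is close to [p] or the second term exceeds 2M. The expectation
    of this bound is e / 2 + K S / N. Continuity of [G] is used at [p] only. *)
Lemma bernstein_cvg G (M : R) p : (forall i, 0 <= p i <= 1) ->
  (forall y, `|G y| <= M) ->
  (forall e : R, 0 < e -> exists2 h : R, 0 < h &
     forall y, (forall i, `|y i - p i| < h) -> `|G y - G p| <= e) ->
  bernstein N G p @[N --> \oo] --> G p.
Proof.
move=> p01 GM Gp.
have M0 : 0 <= M by exact: le_trans (normr_ge0 _) (GM p).
apply/cvgrPdist_le => /= e e0.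
have e20 : 0 < e / 2 by rewrite divr_gt0.
have [h h0 Gh] := Gp _ e20.
pose K := 2 * M / h ^+ 2.
have K0 : 0 <= K by apply: divr_ge0; [exact: mulr_ge0|exact: sqr_ge0].
pose S := \sum_i p i * (1 - p i).
have S0 : 0 <= S.
  by apply: sumr_ge0 => i _; have /andP[? ?] := p01 i; rewrite mulr_ge0// subr_ge0.
have GQ y : `|G y - G p| <= e / 2 + K * \sum_i (y i - p i) ^+ 2.
  have Q0 : 0 <= \sum_i (y i - p i) ^+ 2 by apply: sumr_ge0 => i _; exact: sqr_ge0.
  have [yp|] := pselect (forall i, `|y i - p i| < h).
    by rewrite (le_trans (Gh _ yp))// lerDl mulr_ge0.
  move=> /existsNP[i /negP]; rewrite -leNgt => hi.
  have h2 : h ^+ 2 <= \sum_i (y i - p i) ^+ 2.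
    rewrite (bigD1 i)//= -[leLHS]addr0; apply: lerD.
      by rewrite -(real_normK (num_real (y i - p i))) lerXn2r// nnegrE ltW.
    by apply: sumr_ge0 => j _; exact: sqr_ge0.
  rewrite (@le_trans _ _ (2 * M))//.
    rewrite (le_trans (ler_normB _ _))// mulr_natl mulr2n lerD//.
  rewrite (@le_trans _ _ (K * h ^+ 2))//.
    by rewrite /K divfK// expf_neq0// gt_eqF.
  by apply: ler_wpDl; [exact: ltW|exact: ler_wpM2l].
near=> N.
have N0 : (0 < N)%N by near: N; exact: nbhs_infty_gt.
have KN : K * (N%:R^-1 * S) <= e / 2.
  rewrite mulrCA ler_pdivrMl ?ltr0n// -ler_pdivrMr//.
  by near: N; exact: nbhs_infty_ger.
rewrite distrC ler_norml lerBrDr lerBlDr; apply/andP; split.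
  have := @bernstein_le N (fun y => (G p - e / 2) + (- K) * \sum_i (y i - p i) ^+ 2)
    G p p01.
  rewrite bernstein_quadratic// => le1.
  apply: le_trans (le1 _); last first.
    by move=> y; have := GQ y; rewrite ler_norml => /andP[+ _]; lra.
  by rewrite -/S; lra.
have := @bernstein_le N G (fun y => (G p + e / 2) + K * \sum_i (y i - p i) ^+ 2)
    p p01.
rewrite bernstein_quadratic// => le1.
apply: le_trans (le1 _) _.
  by move=> y; have := GQ y; rewrite ler_norml => /andP[_]; lra.
by rewrite -/S; lra.
Unshelve. all: by end_near. Qed.

End Bernstein.

Lemma continuous_rV_near {R : realType} {n : nat} (phi : 'rV[R]_n -> R) :
  continuous phi -> forall (v : 'rV[R]_n) (e : R), 0 < e ->
  exists2 h : R, 0 < h & forall v' : 'rV[R]_n,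
    (forall j, `|v' ord0 j - v ord0 j| < h) -> `|phi v' - phi v| <= e.
Proof.
move=> cphi v e e0; have /cvgrPdist_le/(_ _ e0) := cphi v.
move=> /nbhs_ballP[h /= h0 hphi]; exists h => // v' v'v.
rewrite distrC; apply: hphi; split=> // i j.
by rewrite ord1 /ball /= distrC.
Qed.

(** * Trigonometric polynomials and the passage from characteristic functions to laws *)

Section TrigonometricPolynomials.
Context {R : realType} {n : nat}.

(** The phase [c] produces the sines, so that generators are of one kind and a single product
    formula suffices. *)
Inductive trigpoly : (('I_n -> R) -> R) -> Prop :=
| Trigpoly_cos (v : 'I_n -> R) (c : R) :
    trigpoly (fun y => cos (\sum_i v i * y i + c))
| Trigpoly_add f g : trigpoly f -> trigpoly g ->
    trigpoly (fun y => f y + g y)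
| Trigpoly_scale (a : R) f : trigpoly f -> trigpoly (fun y => a * f y).

(** On generators this is the product-to-sum formula for cosines; sums and multiples distribute. *)
Lemma trigpoly_mul f g : trigpoly f -> trigpoly g ->
  trigpoly (fun y => f y * g y).
Proof.
elim=> [v c|f1 f2 _ IH1 _ IH2|a f1 _ IH1] gT.
- elim: gT => [v' c'|g1 g2 _ IH1 _ IH2|a g1 _ IH1].
  + have -> : (fun y : 'I_n -> R =>
        cos (\sum_i v i * y i + c) * cos (\sum_i v' i * y i + c')) =
      (fun y => 2^-1 * (cos (\sum_i (v i + v' i) * y i + (c + c')) +
                        cos (\sum_i (v i - v' i) * y i + (c - c')))).
      apply/funext => y.
      have -> : \sum_i (v i + v' i) * y i + (c + c') =
          (\sum_i v i * y i + c) + (\sum_i v' i * y i + c').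
        by rewrite addrACA -big_split /=; congr (_ + _); apply: eq_bigr => i _;
          rewrite mulrDl.
      have -> : \sum_i (v i - v' i) * y i + (c - c') =
          (\sum_i v i * y i + c) - (\sum_i v' i * y i + c').
        by rewrite opprD addrACA -sumrB; congr (_ + _); apply: eq_bigr => i _;
          rewrite mulrBl.
      move: (\sum_i v i * y i + c) (\sum_i v' i * y i + c') => A B.
      by rewrite cosD cosB; field.
    by apply: Trigpoly_scale; apply: Trigpoly_add; exact: Trigpoly_cos.
  + under eq_fun do rewrite mulrDr.
    exact: Trigpoly_add.
  + under eq_fun do rewrite mulrCA.
    exact: Trigpoly_scale.
- under eq_fun do rewrite mulrDl.
  by apply: Trigpoly_add; auto.
- under eq_fun do rewrite -mulrA.
  by apply: Trigpoly_scale; auto.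
Qed.

Lemma trigpoly_cst c : trigpoly (fun=> c).
Proof.
have -> : (fun=> c) =
    (fun y : 'I_n -> R => c * cos (\sum_i (fun=> 0) i * y i + 0)).
  by apply/funext => y; rewrite big1 ?addr0 ?cos0 ?mulr1// => i _; rewrite mul0r.
by apply: Trigpoly_scale; exact: Trigpoly_cos.
Qed.

Lemma trigpoly_sin (a : R) j : trigpoly (fun y => sin (a * y j)).
Proof.
have -> : (fun y : 'I_n -> R => sin (a * y j)) =
    (fun y => cos (\sum_i (if i == j then a else 0) * y i + - (pi / 2))).
  apply/funext => y; rewrite cosBpihalf; congr sin.
  by rewrite (bigD1 j)//= eqxx big1 ?addr0// => i /negbTE ->; rewrite mul0r.
exact: Trigpoly_cos.
Qed.

(** The end points of the walk do not depend on [y], so the values of [G] enter as constants and the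
    result is a polynomial in the [p y j]. *)
Lemma trigpoly_coin_walk l (s : R) G x (p : ('I_n -> R) -> 'I_n -> R) :
  (forall j, trigpoly (fun y => p y j)) ->
  trigpoly (fun y => coin_walk l (p y) s G x).
Proof.
move=> pT; elim: l x => [|j l IH] x /=; first exact: trigpoly_cst.
apply: Trigpoly_add; apply: trigpoly_mul => //.
have -> : (fun y => 1 - p y j) = (fun y => 1 + (-1) * p y j).
  by apply/funext => y; rewrite mulN1r.
by apply: Trigpoly_add; [exact: trigpoly_cst|exact: Trigpoly_scale].
Qed.

Context {d : measure_display} {Omega : measurableType d}.
Variable P : probability Omega R.
Implicit Types Y Z : 'I_n -> Omega -> R.

Lemma measurable_trigpoly f Y : trigpoly f ->
  (forall i, measurable_fun setT (Y i)) ->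
  measurable_fun setT (fun w => f (Y ^~ w)).
Proof.
move=> fT mY; elim: fT => [v c|f1 f2 _ IH1 _ IH2|a f1 _ IH1].
- apply: (measurableT_comp measurable_cos).
  apply: measurable_funD => //.
  by apply: measurable_sum => i; exact: measurable_funM.
- exact: measurable_funD.
- exact: measurable_funM.
Qed.

Lemma trigpoly_bounded f : trigpoly f -> exists M, forall y, `|f y| <= M.
Proof.
elim=> [v c|f1 f2 _ [M1 H1] _ [M2 H2]|a f1 _ [M1 H1]].
- by exists 1 => y; exact: cos_max.
- by exists (M1 + M2) => y; rewrite (le_trans (ler_normD _ _))// lerD.
- by exists (`|a| * M1) => y; rewrite normrM ler_wpM2l.
Qed.

Definition same_char_fun Y Z := forall v : 'I_n -> R,
  \int[P]_w cos (\sum_i v i * Y i w) = \int[P]_w cos (\sum_i v i * Z i w) /\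
  \int[P]_w sin (\sum_i v i * Y i w) = \int[P]_w sin (\sum_i v i * Z i w).

(** By linearity only the generators matter. The addition formula frees them of their phase and
    brings in the sine part of [same_char_fun]. *)
Lemma trigpoly_same_char_fun f Y Z : trigpoly f ->
  (forall i, measurable_fun setT (Y i)) ->
  (forall i, measurable_fun setT (Z i)) ->
  same_char_fun Y Z ->
  \int[P]_w f (Y ^~ w) = \int[P]_w f (Z ^~ w).
Proof.
move=> fT mY mZ YZ.
have Eint g W : trigpoly g -> (forall i, measurable_fun setT (W i)) ->
    P.-integrable setT (EFin \o (fun w => g (W ^~ w))).
  move=> gT mW; have [M gM] := trigpoly_bounded gT.
  by apply: (@bounded_integrable _ _ _ _ _ M) => //; exact: measurable_trigpoly.
elim: fT => [v c|f1 f2 T1 IH1 T2 IH2|a f1 T1 IH1].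
- have cosE W : (forall i, measurable_fun setT (W i)) ->
      \int[P]_w cos (\sum_i v i * W i w + c) =
      cos c * \int[P]_w cos (\sum_i v i * W i w) -
      sin c * \int[P]_w sin (\sum_i v i * W i w).
    move=> mW.
    have mS : measurable_fun setT (fun w => \sum_i v i * W i w).
      by apply: measurable_sum => i; exact: measurable_funM.
    have iC : P.-integrable setT (EFin \o (fun w => cos (\sum_i v i * W i w))).
      apply: (@bounded_integrable _ _ _ _ _ 1); last by move=> w; exact: cos_max.
      exact: (measurableT_comp measurable_cos).
    have iS : P.-integrable setT (EFin \o (fun w => sin (\sum_i v i * W i w))).
      apply: (@bounded_integrable _ _ _ _ _ 1); last by move=> w; exact: sin_max.
      exact: (measurableT_comp measurable_sin).
    have iZ (k : R) h : P.-integrable setT (EFin \o h) ->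
        P.-integrable setT (EFin \o (fun w => k * h w)).
      by move=> ih; exact: (integrableZl measurableT k ih).
    rewrite -!RintegralZl// -RintegralB//; [|exact: iZ|exact: iZ].
    by apply: eq_Rintegral => w _; rewrite cosD mulrC [X in _ - X]mulrC.
  by rewrite !cosE// (YZ v).1 (YZ v).2.
- by rewrite !RintegralD ?IH1 ?IH2//; exact: Eint.
- by rewrite !RintegralZl ?IH1//; exact: Eint.
Qed.

(* The Bernstein polynomials of [y |-> phi (L (2 y - 1))], taken at
   [(1 + sin (y / L)) / 2], are trigonometric polynomials bounded by [M]; they
   tend to [phi (L sin (y / L))], which tends to [phi y] as [L] grows. *)
Lemma same_char_fun_law Y Z (phi : 'rV[R]_n -> R) (M : R) :
  (forall i, measurable_fun setT (Y i)) ->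
  (forall i, measurable_fun setT (Z i)) ->
  same_char_fun Y Z ->
  continuous phi -> (forall v, `|phi v| <= M) ->
  measurable_fun setT (fun w => phi (\row_i Y i w)) /\
  \int[P]_w phi (\row_i Y i w) = \int[P]_w phi (\row_i Z i w).
Proof.
move=> mY mZ YZ cphi phiM.
pose p (L : R) (y : 'I_n -> R) j := (1 + sin (L^-1 * y j)) / 2.
have p01 L y j : 0 <= p L y j <= 1.
  have := sin_le1 (L^-1 * y j); have := sin_geN1 (L^-1 * y j).
  by rewrite /p; lra.
(* [G L] carries the unit cube onto the cube of half-side [L]; its argument is affine of slope
   [2 * L] in each coordinate, hence the radius [h / (2 * L)] below. *)
pose G (L : R) (y : 'I_n -> R) := phi (\row_j (L * (2 * y j - 1))).
have pT L N : trigpoly (fun y => bernstein N (G L) (p L y)).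
  apply: trigpoly_coin_walk => j.
  have -> : (fun y => p L y j) = (fun y => 2^-1 + 2^-1 * sin (L^-1 * y j)).
    by apply/funext => y; rewrite /p; field.
  apply: Trigpoly_add; first exact: trigpoly_cst.
  by apply: Trigpoly_scale; exact: trigpoly_sin.
have GpE (L : R) y : L != 0 -> G L (p L y) = phi (\row_j (L * sin (L^-1 * y j))).
  move=> L0; congr phi; apply/rowP => j; rewrite !mxE /p; congr (_ * _).
  by field.
have near_phi := continuous_rV_near cphi.
have cB (L : R) y : 0 < L -> bernstein N (G L) (p L y) @[N --> \oo] -->
    phi (\row_j (L * sin (L^-1 * y j))).
  move=> L0; rewrite -GpE ?gt_eqF//.
  apply: (@bernstein_cvg _ _ _ M) => // [v|e e0]; first exact: phiM.
  have [h h0 hG] := near_phi (\row_j (L * (2 * p L y j - 1))) _ e0.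
  exists (h / (2 * L)) => [|x xp]; first by rewrite divr_gt0// mulr_gt0.
  apply: hG => j; rewrite !mxE.
  rewrite (_ : _ - _ = 2 * L * (x j - p L y j)); last by ring.
  have L20 : 0 < 2 * L by rewrite mulr_gt0.
  by rewrite normrM (gtr0_norm L20) mulrC -ltr_pdivlMr.
(* Inner limit, at fixed [L]; the outer limit in [L = k.+1%:R] is [step2]. *)
have step1 (L : R) W : 0 < L -> (forall i, measurable_fun setT (W i)) ->
    measurable_fun setT (fun w => phi (\row_j (L * sin (L^-1 * W j w)))) /\
    \int[P]_w bernstein N (G L) (p L (W ^~ w)) @[N --> \oo] -->
    \int[P]_w phi (\row_j (L * sin (L^-1 * W j w))).
  move=> L0 mW; apply: (@bounded_cvg_Rintegral _ _ _ _ _ _ M).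
  - by move=> N; exact: (measurable_trigpoly (pT L N)).
  - by move=> N w; apply: bernstein_norm => // v; exact: phiM.
  - by move=> w; exact: cB.
have cL (y : 'I_n -> R) :
    phi (\row_j (k.+1%:R * sin (k.+1%:R^-1 * y j))) @[k --> \oo] -->
    phi (\row_j y j).
  apply/cvgrPdist_le => /= e e0.
  have [h h0 hphi] := near_phi (\row_j y j) _ e0.
  have : \forall k \near \oo, forall j : 'I_n,
      `|k.+1%:R * sin (k.+1%:R^-1 * y j) - y j| < h.
    apply: filter_forall => j; near=> k; rewrite distrC.
    by near: k; move/cvgrPdist_lt : (@sin_cvg_id R (y j)); exact.
  apply: filterS => k kj; rewrite distrC; apply: hphi => j.
  by rewrite !mxE.
have step2 W : (forall i, measurable_fun setT (W i)) ->
    measurable_fun setT (fun w => phi (\row_j W j w)) /\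
    \int[P]_w phi (\row_j (k.+1%:R * sin (k.+1%:R^-1 * W j w))) @[k --> \oo] -->
    \int[P]_w phi (\row_j W j w).
  move=> mW; apply: (@bounded_cvg_Rintegral _ _ _ _ _ _ M).
  - by move=> k; apply: (step1 _ _ _ mW).1.
  - by move=> k w; exact: phiM.
  - by move=> w; exact: cL.
split; first exact: (step2 _ mY).1.
have eqL (L : R) : 0 < L -> \int[P]_w phi (\row_j (L * sin (L^-1 * Y j w))) =
    \int[P]_w phi (\row_j (L * sin (L^-1 * Z j w))).
  move=> L0; have [_ cY] := step1 _ _ L0 mY; have [_ cZ] := step1 _ _ L0 mZ.
  have E : (fun N => \int[P]_w bernstein N (G L) (p L (Y ^~ w))) =
           (fun N => \int[P]_w bernstein N (G L) (p L (Z ^~ w))).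
    by apply/funext => N; exact: (trigpoly_same_char_fun (pT L N)).
  by rewrite E in cY; exact: (cvg_unique _ cY cZ).
have [_ cY] := step2 _ mY; have [_ cZ] := step2 _ mZ.
have E : (fun k => \int[P]_w phi (\row_j (k.+1%:R * sin (k.+1%:R^-1 * Y j w)))) =
         (fun k => \int[P]_w phi (\row_j (k.+1%:R * sin (k.+1%:R^-1 * Z j w)))).
  by apply/funext => k; exact: eqL.
by rewrite E in cY; exact: (cvg_unique _ cY cZ).
Unshelve. all: by end_near. Qed.

End TrigonometricPolynomials.

(** * Slutsky's lemma *)

Section Slutsky.
Context {R : realType} {n : nat}.

(** Heine's theorem by compactness of the closed ball. Only the centre [a] is confined to the ball;
    [y] is free, as needed when nothing but its distance to [a] is known. *)
Lemma compact_unif_near (phi : 'rV[R]_n -> R) (K e : R) :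
  continuous phi -> 0 < e -> exists2 h : R, 0 < h &
  forall a : 'rV[R]_n, `|a| <= K -> forall y : 'rV[R]_n,
    (forall j, `|y ord0 j - a ord0 j| < h) -> `|phi y - phi a| <= e.
Proof.
move=> cphi e0.
have cptK : compact [set a : 'rV[R]_n | `|a| <= K].
  apply: bounded_closed_compact.
    exists K; split; first exact: num_real.
    by move=> x Kx a /= aK; exact: le_trans aK (ltW Kx).
  rewrite (_ : [set _ | _] = closed_ball_ Num.Def.normr 0 K).
    exact: closed_closed_ball_.
  by apply/seteqP; split => a; rewrite /closed_ball_ /= sub0r normrN.
have /compact_near_coveringP := cptK.
move=> /(_ R 0^'+ (fun h a => forall y : 'rV[R]_n,
  (forall j, `|y ord0 j - a ord0 j| < h) -> `|phi y - phi a| <= e) _)[].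
  move=> x _.
  have e20 : 0 < e / 2 by rewrite divr_gt0.
  have [r r0 hr] := continuous_rV_near cphi x e20.
  have r20 : 0 < r / 2 by rewrite divr_gt0.
  (* Two distances below [r / 2], from [x] to [a] and from [a] to [y], keep both points within [r]
     of [x]. *)
  exists (ball x (r / 2), [set h | h < r / 2]); first split => /=.
  - exact: nbhsx_ballx.
  - exact: nbhs_right_lt.
  move=> [a h] /= [[_ xa] hr2] y ya.
  have xaj j : `|a ord0 j - x ord0 j| < r / 2 by rewrite distrC; exact: xa.
  have H1 : `|phi a - phi x| <= e / 2.
    by apply: hr => j; rewrite (lt_trans (xaj j))//; lra.
  have H2 : `|phi y - phi x| <= e / 2.
    apply: hr => j.
    rewrite (_ : _ - _ = (y ord0 j - a ord0 j) + (a ord0 j - x ord0 j)); last by ring.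
    by rewrite (le_lt_trans (ler_normD _ _))//; have := xaj j; have := ya j; lra.
  rewrite (_ : _ - _ = (phi y - phi x) - (phi a - phi x)); last by ring.
  by rewrite (le_trans (ler_normB _ _))//; lra.
move=> r /= r0 hr; exists (r / 2); first by rewrite divr_gt0.
move=> a aK y ya.
apply: (hr (r / 2)) => //=; last by rewrite divr_gt0.
by rewrite sub0r normrN gtr0_norm; lra.
Qed.

(** A continuous bounded substitute for the indicator of |x| >= h. For small [h] its expectation
    measures convergence to 0 in probability, for large [h] it measures tightness. *)
Definition trunc (h x : R) : R := Num.min 1 (`|x| / h).

Lemma trunc_ge0 (h x : R) : 0 < h -> 0 <= trunc h x.
Proof. by move=> h0; rewrite le_min ler01 divr_ge0// ltW. Qed.

Lemma trunc_le1 h x : trunc h x <= 1.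
Proof. by rewrite ge_min lexx. Qed.

Lemma trunc_norm (h x : R) : 0 < h -> `|trunc h x| <= 1.
Proof. by move=> h0; rewrite ger0_norm ?trunc_le1// trunc_ge0. Qed.

Lemma trunc_ge (h x : R) : 0 < h -> h <= `|x| -> trunc h x = 1.
Proof. by move=> h0 hx; apply/min_idPl; rewrite ler_pdivlMr// mul1r. Qed.

Lemma measurable_trunc h : measurable_fun [set: R] (trunc h).
Proof.
apply: measurable_minr => //; apply: measurable_funM => //.
Qed.

Lemma continuous_trunc h : continuous (trunc h).
Proof.
move=> x; apply: (@continuous_min _ _ (cst 1) (fun x : R => `|x| / h)).
  exact: cst_continuous.
have c1 : `|u| @[u --> x] --> `|x| by exact: norm_continuous.
exact: (cvgM c1 (cvg_cst _)).
Qed.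

Lemma trunc_cvg0 x : trunc k.+1%:R x @[k --> \oo] --> (0 : R).
Proof.
apply/cvgrPdist_le => /= e e0; near=> k.
rewrite sub0r normrN ger0_norm ?trunc_ge0// ge_min; apply/orP; right.
rewrite ler_pdivrMr// mulrC -ler_pdivrMr//.
apply: (@le_trans _ _ k%:R); last by rewrite ler_nat.
by near: k; exact: nbhs_infty_ger.
Unshelve. all: by end_near. Qed.

Context {d : measure_display} {Omega : measurableType d}.
Variable P : probability Omega R.

(** Tightness of a single random variable. *)
Lemma Rintegral_trunc_cvg0 (X : Omega -> R) : measurable_fun setT X ->
  \int[P]_w trunc k.+1%:R (X w) @[k --> \oo] --> (0 : R).
Proof.
move=> mX; have <- : \int[P]_w (cst 0 : Omega -> R) w = 0.
  by rewrite Rintegral_cst// mul0r.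
have [|||//] := @bounded_cvg_Rintegral _ _ _ P
  (fun k w => trunc k.+1%:R (X w)) (cst 0) 1.
- by move=> k; exact: (measurableT_comp (measurable_trunc _) mX).
- by move=> k w; exact: trunc_norm.
- by move=> w; exact: trunc_cvg0.
Qed.

(** Near [F] the vector [A t] has exactly the law of [Z], so a ball that is good for [Z] is good for
    all these [A t] at once. It remains to compare [phi] at [Y t] and [A t], by uniform continuity
    when [A t] is in the ball and [Y t] is close, and by [2 * M] otherwise. Sequences occur only in
    the choice of the ball, so the filter can be arbitrary. *)
Lemma slutsky {T : Type} (F : set_system T) {FF : Filter F}
    (Y A : T -> 'I_n -> Omega -> R) (Z : 'I_n -> Omega -> R)
    (phi : 'rV[R]_n -> R) (M : R) :
  (forall i, measurable_fun setT (Z i)) ->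
  (\forall t \near F, [/\ forall i, measurable_fun setT (Y t i),
     forall i, measurable_fun setT (A t i) & same_char_fun P (A t) Z]) ->
  (forall i (h : R), 0 < h ->
     \int[P]_w trunc h (Y t i w - A t i w) @[t --> F] --> (0 : R)) ->
  continuous phi -> (forall v, `|phi v| <= M) ->
  \int[P]_w phi (\row_i Y t i w) @[t --> F] --> \int[P]_w phi (\row_i Z i w).
Proof.
move=> mZ mYA YA0 cphi phiM.
have M0 : 0 <= M by exact: le_trans (normr_ge0 _) (phiM 0).
apply/cvgrPdist_le => /= e e0.
(* The final error is [D * e']: one [e'] from uniform continuity, [2 * M * e'] from the tail of
   [A t], and [2 * M * e'] for each of the [n] coordinates. *)
pose D := 1 + 2 * M + 2 * M * n%:R.
have D0 : 0 < D by rewrite /D -addrA ltr_pwDl// addr_ge0// ?mulr_ge0.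
pose e' := e / D.
have e'0 : 0 < e' by rewrite divr_gt0.
(* A cut-off equal to 1 outside the ball of radius [k.+1%:R]. Being continuous, it has the same
   expectation at [A t] and at [Z]. *)
pose chi k (v : 'rV[R]_n) := trunc k.+1%:R `|v|.
have cchi k : continuous (chi k).
  move=> v; apply: (@continuous_comp _ _ _ (fun v : 'rV[R]_n => `|v|) (trunc k.+1%:R)).
    exact: (@norm_continuous _ 'rV[R]_n v).
  exact: continuous_trunc.
have chi1 k v : `|chi k v| <= 1 by exact: trunc_norm.
have mphi (W : 'I_n -> Omega -> R) (psi : 'rV[R]_n -> R) : (forall i, measurable_fun setT (W i)) -> continuous psi ->
    (exists M, forall v, `|psi v| <= M) ->
    measurable_fun setT (fun w => psi (\row_i W i w)).
  move=> mW cpsi [M' psiM].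
  (* Taking both vectors equal extracts the measurability part of [same_char_fun_law]. *)
  have WW : same_char_fun P W W by [].
  by have [] := same_char_fun_law mW mW WW cpsi psiM.
have [k chik] : exists k, \int[P]_w chi k (\row_i Z i w) <= e'.
  have : \int[P]_w chi k (\row_i Z i w) @[k --> \oo] --> (0 : R).
    have <- : \int[P]_w (cst 0 : Omega -> R) w = 0.
      by rewrite Rintegral_cst// mul0r.
    have [|||//] := @bounded_cvg_Rintegral _ _ _ P
      (fun k w => chi k (\row_i Z i w)) (cst 0) 1.
    - by move=> k; apply: mphi => //; exists 1.
    - by move=> k w; exact: chi1.
    - by move=> w; exact: trunc_cvg0.
  move=> /cvgrPdist_le/(_ _ e'0)[k _ /(_ k (leqnn k))] /=.
  rewrite sub0r normrN => h; exists k; exact: le_trans (ler_norm _) h.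
have [h h0 hphi] := compact_unif_near k.+1%:R cphi e'0.
have : \forall t \near F, forall i,
    \int[P]_w trunc h (Y t i w - A t i w) <= e'.
  apply: filter_forall => i; have /cvgrPdist_le/(_ _ e'0) := YA0 i _ h0.
  by apply: filterS => t; rewrite sub0r normrN; exact: le_trans (ler_norm _).
move: mYA; apply: filterS2 => t [mY mA AZ] trt.
have [mphiA phiAZ] := same_char_fun_law mA mZ AZ cphi phiM.
have [_ chiAZ] := same_char_fun_law mA mZ AZ (@cchi k) (chi1 k).
have mphiY : measurable_fun setT (fun w => phi (\row_i Y t i w)).
  by apply: mphi => //; exists M.
have iphi (W : 'I_n -> Omega -> R) : measurable_fun setT (fun w => phi (\row_i W i w)) ->
    P.-integrable setT (EFin \o (fun w => phi (\row_i W i w))).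
  by move=> mW; exact: bounded_integrable mW _.
have mtr i : measurable_fun setT (fun w => trunc h (Y t i w - A t i w)).
  apply: measurableT_comp (measurable_trunc h) _.
  exact: measurable_funB.
have itr i : P.-integrable setT (EFin \o (fun w => trunc h (Y t i w - A t i w))).
  by apply: (@bounded_integrable _ _ _ _ _ 1) => // w; exact: trunc_norm.
have ichi : P.-integrable setT (EFin \o (fun w => chi k (\row_i A t i w))).
  apply: (@bounded_integrable _ _ _ _ _ 1) => //.
  by apply: mphi => //; exists 1.
have iZ (c : R) (f : Omega -> R) : P.-integrable setT (EFin \o f) ->
    P.-integrable setT (EFin \o (fun w => c * f w)).
  by move=> ih; exact: (integrableZl measurableT c ih).
have iD (f g : Omega -> R) : P.-integrable setT (EFin \o f) ->
    P.-integrable setT (EFin \o g) ->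
    P.-integrable setT (EFin \o (fun w => f w + g w)).
  by move=> i1 i2; exact: (integrableD measurableT i1 i2).
have ic (c : R) : P.-integrable setT (EFin \o (fun=> c)).
  by apply: (@bounded_integrable _ _ _ _ _ `|c|).
have isum : P.-integrable setT
    (EFin \o (fun w => \sum_i trunc h (Y t i w - A t i w))).
  apply: (@bounded_integrable _ _ _ _ _ (\sum_(i < n) 1)).
    exact: measurable_sum.
  move=> w; rewrite (le_trans (ler_norm_sum _ _ _))//.
  by apply: ler_sum => i _; exact: trunc_norm.
have sumE : \int[P]_w (\sum_i trunc h (Y t i w - A t i w)) =
    \sum_i \int[P]_w trunc h (Y t i w - A t i w).
  rewrite /Rintegral sum_fine; last first.
    by move=> i _; exact: (integrable_fin_num measurableT (itr i)).
  by rewrite -(integral_sum measurableT itr); congr fine; apply: eq_integral => w _; rewrite sumEFin.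
rewrite -phiAZ -RintegralB//; [|exact: iphi|exact: iphi].
apply: le_trans (le_normr_Rintegral measurableT _) _.
  have i1 := iphi _ mphiA; have i2 := iZ (-1) _ (iphi _ mphiY).
  by have := iD _ _ i1 i2; under eq_fun do rewrite /= mulN1r.
(* Pointwise, one term suffices in each case: [chi] is 1 if [a] leaves the ball, some [trunc] is 1
   if a coordinate is off by [h], and [e'] covers the rest. *)
apply: (@le_trans _ _ (\int[P]_w (e' + 2 * M * chi k (\row_i A t i w) +
    2 * M * \sum_i trunc h (Y t i w - A t i w)))).
  apply: le_Rintegral => //.
  - apply: (@bounded_integrable _ _ _ _ _ (M + M)).
      by apply: measurableT_comp => //; exact: measurable_funB.
    by move=> w; rewrite normr_id (le_trans (ler_normB _ _))// lerD.
  - by apply: (iD); [apply: (iD)|]; auto.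
  move=> w _; rewrite distrC.
  set a := \row_i A t i w; set y := \row_i Y t i w.
  have S0 : 0 <= \sum_i trunc h (Y t i w - A t i w).
    by apply: sumr_ge0 => i _; exact: trunc_ge0.
  have C0 : 0 <= chi k a by exact: trunc_ge0.
  have ya2M : `|phi y - phi a| <= 2 * M.
    by rewrite (le_trans (ler_normB _ _))// mulr_natl mulr2n lerD.
  have M20 : 0 <= 2 * M by rewrite mulr_ge0.
  have [ak|/ltW ak] := leP `|a| k.+1%:R; last first.
    have -> : chi k a = 1 by apply: trunc_ge => //; rewrite normr_id.
    rewrite mulr1; apply: le_trans ya2M _.
    rewrite -addrA; apply: ler_wpDl; first exact: ltW.
    by apply: ler_wpDr => //; exact: mulr_ge0.
  have [yah|] := pselect (forall j, `|y ord0 j - a ord0 j| < h).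
    apply: le_trans (hphi _ ak _ yah) _; rewrite -addrA; apply: ler_wpDr => //.
    by apply: addr_ge0; exact: mulr_ge0.
  move=> /existsNP[j /negP]; rewrite -leNgt !mxE => hj.
  apply: le_trans ya2M _; apply: ler_wpDl.
    by apply: addr_ge0; [exact: ltW|exact: mulr_ge0].
  rewrite -[leLHS]mulr1; apply: ler_wpM2l => //.
  rewrite (bigD1 j)//= (trunc_ge h0 hj); apply: ler_wpDr => //.
  by apply: sumr_ge0 => i _; exact: trunc_ge0.
rewrite RintegralD//; [|by apply: (iD); auto|exact: iZ].
rewrite RintegralD//; [|exact: iZ].
rewrite !RintegralZl// sumE chiAZ Rintegral_cst//.
rewrite [X in _ * fine X]probability_setT mulr1.
apply: (@le_trans _ _ (e' + 2 * M * e' + 2 * M * (n%:R * e'))).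
  apply: lerD.
    by apply: lerD => //; apply: ler_wpM2l => //; rewrite mulr_ge0.
  apply: ler_wpM2l; first by rewrite mulr_ge0.
  rewrite (_ : n%:R * e' = \sum_(i < n) e'); first exact: ler_sum.
  by rewrite sumr_const card_ord mulr_natl.
rewrite (_ : _ + _ = D * e'); last by rewrite /D; ring.
by rewrite /e' mulrC divfK// gt_eqF.
Unshelve. all: by end_near. Qed.

End Slutsky.

(** * The L^alpha norms of the kernels *)

Section LebesgueIntegrals.
Context {R : realType}.
Let mu := @lebesgue_measure R.

(** The image of Lebesgue measure under multiplication by [c], scaled by [c], agrees with Lebesgue
    measure on intervals, hence everywhere by uniqueness. *)
Lemma ge0_integral_dilation (c : R) (f : R -> \bar R) : 0 < c ->
  measurable_fun [set: R] f -> (forall x, 0 <= f x)%E ->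
  (\int[mu]_x (c%:E * f (c * x)%R) = \int[mu]_x f x)%E.
Proof.
move=> c0 mf f0.
have mc : measurable_fun [set: R] (( *%R c) : R -> measurableTypeR R).
  exact: measurable_funM.
pose nu_ : measure (measurableTypeR R) R :=
  mscale (NngNum (ltW c0)) (pushforward mu (( *%R c) : R -> measurableTypeR R)).
pose nu := nu_ mc.
have nuE (A : set R) : measurable A -> nu A = mu A.
  move=> mA; apply/esym; apply: (@lebesgue_measure_unique _ nu) => //.
  move=> _ [[a b]] _ <-.
  rewrite /nu /nu_ /= /mscale /= /pushforward.
  rewrite (_ : _ @^-1` _ = `]c^-1 * a, c^-1 * b]%classic); last first.
    by apply/seteqP; split => x /=; rewrite !in_itv/= ltr_pdivrMl// ler_pdivlMl.
  rewrite !lebesgue_measure_itv/= !lte_fin ltr_pM2l ?invr_gt0//.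
  case: ifPn => _; last by rewrite mule0.
  by rewrite -!EFinB -EFinM -mulrBr mulVKf// gt_eqF.
rewrite -[RHS](@eq_measure_integral _ _ _ setT mu nu); last first.
  by move=> A mA _; exact: nuE.
rewrite /nu /nu_ ge0_integral_mscale//= ge0_integral_pushforward//=.
rewrite preimage_setT ge0_integralZl_EFin//; last exact: ltW.
exact: measurableT_comp.
Qed.

Lemma integral_itv_powR (u v r : R) : 0 < u -> u < v -> r != 0 ->
  (\int[mu]_(x in `[u, v]) (x `^ (r - 1))%:E = ((v `^ r - u `^ r) / r)%:E)%E.
Proof.
move=> u0 uv r0.
have pos x : u <= x -> x \in `]0, +oo[.
  by move=> ux; rewrite in_itv/= andbT (lt_le_trans u0).
have dp (q x : R) : u <= x -> derivable (fun y : R => y `^ q) x 1.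
  by move=> ux; exact: (derivable_powR (pos _ ux)).
have cF (x : R) : u <= x -> {for x, continuous (fun y : R => y `^ r / r)}.
  move=> ux; apply: differentiable_continuous; apply/derivable1_diffP.
  by apply: derivableM => //; exact: dp.
rewrite (@continuous_FTC2 _ _ (fun x : R => x `^ r / r))//.
- by rewrite -EFinB -mulrBl.
- apply: derivable_within_continuous => x; rewrite in_itv/= => /andP[ux _].
  exact: dp.
- split.
  + move=> x; rewrite in_itv/= => /andP[/ltW ux _].
    by apply: derivableM => //; exact: dp.
  + by apply: cvg_at_right_filter; exact: cF.
  + by apply: cvg_at_left_filter; apply: cF; exact: ltW.
- move=> x; rewrite in_itv/= => /andP[/ltW ux _].
  rewrite derive1E deriveM//; last exact: dp.
  rewrite derive_cst scaler0 add0r -derive1E powR_derive1 ?pos//.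
  by rewrite /GRing.scale /= mulrA mulVf// mul1r.
Qed.

(** The exponents are normalised so that [0 < a] means integrability at 0 and [0 < b] integrability
    at infinity. *)
Definition two_powers (a b x : R) : R :=
  if `|x| <= 1 then `|x| `^ (a - 1) else `|x| `^ (- b - 1).

Lemma two_powers_ge0 a b x : 0 <= two_powers a b x.
Proof. by rewrite /two_powers; case: ifP => _; exact: powR_ge0. Qed.

Lemma measurable_two_powers a b : measurable_fun [set: R] (two_powers a b).
Proof.
apply: measurable_fun_ifT => /=.
- apply: measurable_fun_ler => //.
- exact: (measurableT_comp (measurable_powR _)).
- exact: (measurableT_comp (measurable_powR _)).
Qed.

(** The positive half-line is exhausted by compact intervals, on each of which the integral is at
    most 1/a + 1/b; monotone convergence and reflection conclude. *)
Lemma integral_two_powers_lty (a b : R) : 0 < a -> 0 < b ->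
  (\int[mu]_x (two_powers a b x)%:E < +oo)%E.
Proof.
move=> a0 b0.
have mf : measurable_fun [set: R] (fun x => (two_powers a b x)%:E).
  by apply/measurable_EFinP; exact: measurable_two_powers.
have f0 x : (0 <= (two_powers a b x)%:E)%E by rewrite lee_fin two_powers_ge0.
(* With [n.+2], the point 1 where the two powers meet is interior to every [J n]. *)
pose J n : set R := `[n.+2%:R^-1, n.+2%:R]%classic.
have Jlt (n : nat) : n.+2%:R^-1 < 1 :> R by rewrite invf_lt1// ltr1n.
have J0 (n : nat) : 0 < n.+2%:R^-1 :> R by rewrite invr_gt0.
have intJ n : (\int[mu]_(x in J n) (two_powers a b x)%:E <= (a^-1 + b^-1)%:E)%E.
  have -> : J n = `[n.+2%:R^-1, 1]%classic `|` `]1, n.+2%:R]%classic.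
    have n2 : 1 < n.+2%:R :> R by rewrite ltr1n.
    have n2' := Jlt n.
    apply/seteqP; split => x; rewrite /J /= !in_itv/=.
      by move=> /andP[x1 x2]; have [h|h] := leP x 1; [left|right]; apply/andP.
    case=> /andP[x1 x2]; apply/andP; split => //.
      exact: le_trans x2 (ltW n2).
    exact: ltW (lt_trans n2' x1).
  rewrite ge0_integral_setU//; last 2 first.
  - exact: measurable_funTS.
  - rewrite disj_set2E; apply/eqP; rewrite -subset0 => x [] /=.
    by rewrite !in_itv/=; lra.
  rewrite EFinD; apply: leeD.
    rewrite (_ : (\int[_]_(x in _) _)%E =
        (\int[mu]_(x in `[(n.+2%:R^-1)%R, 1%R]%classic) (x `^ (a - 1))%:E)%E); last first.
      apply: eq_integral => x; rewrite inE/= in_itv/= => /andP[x0 x1].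
      have x00 : 0 < x by exact: lt_le_trans x0.
      by rewrite /two_powers gtr0_norm// x1.
    rewrite integral_itv_powR ?gt_eqF// powR1 lee_fin.
    by rewrite ler_pdivrMr// mulVf ?gt_eqF// gerBl powR_ge0.
  rewrite (_ : (\int[_]_(x in _) _)%E =
      (\int[mu]_(x in `]1%R, (n.+2%:R)%R]%classic) (x `^ (- b - 1))%:E)%E); last first.
    apply: eq_integral => x; rewrite inE/= in_itv/= => /andP[x1 _].
    have x00 : 0 < x by exact: lt_trans x1.
    by rewrite /two_powers gtr0_norm// leNgt x1.
  rewrite integral_itv_obnd_cbnd; last first.
    by apply: measurable_funTS; apply/measurable_EFinP; exact: measurable_powR.
  rewrite integral_itv_powR ?oppr_eq0 ?gt_eqF ?ltr1n// powR1 lee_fin.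
  rewrite invrN mulrN -mulNr opprB ler_pdivrMr// mulVf ?gt_eqF// gerBl powR_ge0.
have mJ n : measurable (J n) by exact: measurable_itv.
have nJ : nondecreasing_seq J.
  move=> m n mn; rewrite subsetEset => x; rewrite /J /= !in_itv/= => /andP[x1 x2].
  have mn2 : m.+2%:R <= n.+2%:R :> R by rewrite ler_nat.
  rewrite (le_trans x2)// andbT; apply: le_trans x1.
  by rewrite lef_pV2// posrE ltr0n.
have UJ : \bigcup_n J n = `]0, +oo[%classic.
  apply/seteqP; split => x.
    by move=> [n _]; rewrite /J /= !in_itv/= andbT => /andP[+ _]; exact: lt_le_trans.
  rewrite /= in_itv/= andbT => x0.
  have := archi_boundP (ltW x0); have x'0 : 0 < x^-1 by rewrite invr_gt0.
  have := archi_boundP (ltW x'0).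
  set k := Num.bound x^-1; set m := Num.bound x => kx mx.
  exists (k + m)%N => //; rewrite /J /= in_itv/=; apply/andP; split.
    rewrite -[leRHS]invrK lef_pV2// ?posrE// ?ltr0n//.
    by rewrite (le_trans (ltW kx))// ler_nat -addn2 -addnA leq_addr.
  by rewrite (le_trans (ltW mx))// ler_nat -addn2 -addnA addnCA leq_addr.
have half : (\int[mu]_(x in `[0%R, +oo[) (two_powers a b x)%:E <= (a^-1 + b^-1)%:E)%E.
  rewrite -integral_itv_obnd_cbnd; last exact: measurable_funTS.
  rewrite -UJ.
  have cv : (\int[mu]_(x in J i) (two_powers a b x)%:E @[i --> \oo] -->
      \int[mu]_(x in \bigcup_i J i) (two_powers a b x)%:E)%E.
    by apply: ge0_nondecreasing_set_cvg_integral => // n; exact: measurable_funTS.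
  rewrite -(cvg_lim _ cv)//; apply: lime_le; first by apply/cvg_ex; eexists; exact: cv.
  by apply: nearW => n; exact: intJ.
have -> : [set: R] = `]-oo, 0]%classic `|` `]0, +oo[%classic.
  by apply/seteqP; split => x //= _; rewrite !in_itv/= andbT; apply/orP; case: leP.
rewrite ge0_integral_setU//; last 2 first.
- exact: measurable_funTS.
- rewrite disj_set2E; apply/eqP; rewrite -subset0 => x [] /=.
  by rewrite !in_itv/= andbT; lra.
apply: lte_add_pinfty.
  have -> : (\int[mu]_(x in `]-oo, 0%R]) (two_powers a b x)%:E =
      \int[mu]_(x in `[0%R, +oo[) (two_powers a b x)%:E)%E.
    rewrite ge0_integration_by_substitution0//.
    by apply: eq_integral => x _; rewrite /two_powers normrN.
  exact: le_lt_trans half (ltry _).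
rewrite integral_itv_obnd_cbnd; last exact: measurable_funTS.
exact: le_lt_trans half (ltry _).
Qed.

End LebesgueIntegrals.

(** * Bounds on the kernels and their behaviour under dilation *)

Section Kernels.
Context {R : realType}.
Implicit Types (f g : R -> R * R) (a b c x alpha h s k q t e : R).
Let mu := @lebesgue_measure R.

Lemma cmod_ge0 f x : 0 <= cmod f x.
Proof. exact: sqrtr_ge0. Qed.

Lemma sqrt_sum_scale c a b :
  Num.sqrt ((c * a) ^+ 2 + (c * b) ^+ 2) = `|c| * Num.sqrt (a ^+ 2 + b ^+ 2).
Proof.
by rewrite !exprMn -mulrDr sqrtrM ?sqr_ge0// sqrtr_sqr.
Qed.

Lemma measurable_cmod f : measurable_fun [set: R] (fun x => (f x).1) ->
  measurable_fun [set: R] (fun x => (f x).2) -> measurable_fun [set: R] (cmod f).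
Proof.
move=> m1 m2.
have -> : cmod f = (fun x => ((f x).1 ^+ 2 + (f x).2 ^+ 2) `^ 2^-1).
  by apply/funext => x; rewrite powR12_sqrt// addr_ge0// sqr_ge0.
apply: (measurableT_comp (measurable_powR _)).
by apply: measurable_funD; exact: measurable_funX.
Qed.

Lemma measurable_cmod_pow alpha f : measurable_fun [set: R] (fun x => (f x).1) ->
  measurable_fun [set: R] (fun x => (f x).2) ->
  measurable_fun [set: R] (fun x => ((cmod f x) `^ alpha)%:E).
Proof.
move=> m1 m2; apply/measurable_EFinP.
by apply: (measurableT_comp (measurable_powR _)); exact: measurable_cmod.
Qed.

Lemma cmod_le f x : cmod f x <= `|(f x).1| + `|(f x).2|.
Proof.
rewrite -(@ler_pXn2r _ 2%N)// ?nnegrE ?cmod_ge0 ?addr_ge0//.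
rewrite sqr_sqrtr ?addr_ge0 ?sqr_ge0//.
rewrite -(real_normK (num_real (f x).1)) -(real_normK (num_real (f x).2)).
have := normr_ge0 (f x).1; have := normr_ge0 (f x).2.
by move: (`|_|) (`|_|) => u v u0 v0; nra.
Qed.

Lemma cmod_ge1 f x : `|(f x).1| <= cmod f x.
Proof. by rewrite -sqrtr_sqr ler_sqrt ?addr_ge0 ?sqr_ge0// lerDl sqr_ge0. Qed.

Lemma cmod_ge2 f x : `|(f x).2| <= cmod f x.
Proof. by rewrite -sqrtr_sqr ler_sqrt ?addr_ge0 ?sqr_ge0// lerDr sqr_ge0. Qed.

Lemma cmod_lincomb a b f g x :
  cmod (lincomb a b f g) x <= 2 * (`|a| * cmod f x + `|b| * cmod g x).
Proof.
apply: le_trans (cmod_le _ _) _; rewrite /= mulr_natl mulr2n.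
apply: lerD; apply: le_trans (ler_normD _ _) _; rewrite !normrM; apply: lerD;
  apply: ler_wpM2l => //; by [exact: cmod_ge1|exact: cmod_ge2].
Qed.

(** The sum [u + v] is at most twice the larger of the two. *)
Lemma powR_add_le (p u v : R) : 0 <= p -> 0 <= u -> 0 <= v ->
  (u + v) `^ p <= 2 `^ p * (u `^ p + v `^ p).
Proof.
move=> p0 u0 v0; rewrite mulrDr -!powRM//.
wlog uv : u v u0 v0 / u <= v => [hw|].
  have [uv|/ltW vu] := leP u v; first exact: hw.
  by rewrite addrC [leRHS]addrC; exact: hw.
apply: ler_wpDl; first exact: powR_ge0.
apply: ge0_ler_powR => //; rewrite ?nnegrE ?addr_ge0 ?mulr_ge0//.
by rewrite mulr_natl mulr2n lerD2r.
Qed.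

Lemma admissible_lincomb alpha a b f g : 0 <= alpha ->
  admissible alpha f -> admissible alpha g -> admissible alpha (lincomb a b f g).
Proof.
move=> al0 [hf mf1 mf2 finf] [hg mg1 mg2 fing].
have m1 : measurable_fun [set: R] (fun x => (lincomb a b f g x).1).
  by apply: measurable_funD; exact: measurable_funM.
have m2 : measurable_fun [set: R] (fun x => (lincomb a b f g x).2).
  by apply: measurable_funD; exact: measurable_funM.
split; [|exact: m1|exact: m2|].
  move=> x; rewrite /lincomb /=.
  by have [-> ->] := hf x; have [-> ->] := hg x; split; ring.
(* In the constant 4, one factor 2 comes from [cmod_lincomb] and the other from [powR_add_le]. *)
pose A := 4 `^ alpha * `|a| `^ alpha; pose B := 4 `^ alpha * `|b| `^ alpha.
have A0 : 0 <= A by rewrite mulr_ge0// powR_ge0.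
have B0 : 0 <= B by rewrite mulr_ge0// powR_ge0.
have mF := measurable_cmod_pow alpha mf1 mf2.
have mG := measurable_cmod_pow alpha mg1 mg2.
apply: (@le_lt_trans _ _ (A%:E * Lalpha_pow alpha f + B%:E * Lalpha_pow alpha g)%E).
  rewrite /Lalpha_pow -!ge0_integralZl_EFin//; last 2 first.
  - by move=> x _; rewrite lee_fin powR_ge0.
  - by move=> x _; rewrite lee_fin powR_ge0.
  rewrite -ge0_integralD//; last 4 first.
  - by move=> x _; rewrite -EFinM lee_fin mulr_ge0// powR_ge0.
  - exact: measurable_funeM.
  - by move=> x _; rewrite -EFinM lee_fin mulr_ge0// powR_ge0.
  - exact: measurable_funeM.
  apply: ge0_le_integral => //.
  - by move=> x _; rewrite lee_fin powR_ge0.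
  - exact: measurable_cmod_pow.
  - by apply: emeasurable_funD; exact: measurable_funeM.
  move=> x _; rewrite -!EFinM -EFinD lee_fin.
  have F0 := cmod_ge0 f x; have G0 := cmod_ge0 g x.
  apply: (@le_trans _ _ ((2 * (`|a| * cmod f x + `|b| * cmod g x)) `^ alpha)).
    apply: ge0_ler_powR => //; rewrite ?nnegrE ?cmod_ge0// ?cmod_lincomb//.
    by rewrite mulr_ge0// addr_ge0// mulr_ge0.
  rewrite powRM// ?addr_ge0 ?mulr_ge0//.
  apply: (@le_trans _ _ (2 `^ alpha *
      (2 `^ alpha * ((`|a| * cmod f x) `^ alpha + (`|b| * cmod g x) `^ alpha)))).
    by apply: ler_wpM2l; rewrite ?powR_ge0// powR_add_le// mulr_ge0.
  have E4 : 4 `^ alpha = 2 `^ alpha * 2 `^ alpha :> R.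
    by rewrite -powRM//; congr (_ `^ _); ring.
  by rewrite mulrA !powRM// mulrDr !mulrA /A /B E4.
apply: lte_add_pinfty.
  by apply: lte_mul_pinfty; [rewrite lee_fin; exact: A0|exact: isT|exact: finf].
by apply: lte_mul_pinfty; [rewrite lee_fin; exact: B0|exact: isT|exact: fing].
Qed.

Lemma kernE alpha h s x : kern alpha h s x =
  ((cos (s * x) - 1) / `|x| `^ (alpha^-1 + h), sin (s * x) / `|x| `^ (alpha^-1 + h)).
Proof.
rewrite /kern; case: ifPn => // /eqP ->.
by rewrite mulr0 cos0 sin0 subrr !mul0r.
Qed.

Lemma kern_hermitian alpha h s : Defs.hermitian (kern alpha h s).
Proof. by move=> x; rewrite !kernE /= mulrN cosN sinN normrN mulNr. Qed.

Lemma measurable_kern alpha h s :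
  measurable_fun [set: R] (fun x => (kern alpha h s x).1) /\
  measurable_fun [set: R] (fun x => (kern alpha h s x).2).
Proof.
have ms : measurable_fun [set: R] ( *%R s) by exact: measurable_funM.
have mp : measurable_fun [set: R] (fun x => (`|x| `^ (alpha^-1 + h))^-1).
  under eq_fun do rewrite -powRN.
  exact: (measurableT_comp (measurable_powR _)).
split; under eq_fun do rewrite kernE /=; apply: measurable_funM => //.
  by apply: measurable_funB => //; exact: (measurableT_comp measurable_cos).
exact: (measurableT_comp measurable_sin).
Qed.

(** This is |e^{isx} - 1|, the modulus of the numerator of [kern]. *)
Definition osc (s x : R) : R := Num.sqrt ((cos (s * x) - 1) ^+ 2 + sin (s * x) ^+ 2).

(** The square of [osc s x] is 2 (1 - cos (s x)), which is at most 4 and at most (s x)^2. *)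
Lemma osc_le s x : osc s x <= (2 + `|s|) * Num.min 1 `|x|.
Proof.
have oscE : osc s x = Num.sqrt (2 * (1 - cos (s * x))).
  by congr Num.sqrt; rewrite sin2cos2; ring.
have o2 : osc s x <= 2.
  rewrite oscE -[leRHS]ger0_norm// -sqrtr_sqr ler_sqrt ?sqr_ge0//.
  by have := cos_geN1 (s * x); lra.
have os : osc s x <= `|s| * `|x|.
  rewrite oscE -normrM -sqrtr_sqr ler_sqrt ?sqr_ge0//.
  by have := onem_cos_le (s * x); lra.
have [x1|x1] := leP 1 `|x|.
  by rewrite mulr1; apply: le_trans o2 _; rewrite lerDl.
apply: le_trans os _; apply: ler_wpM2r => //.
by rewrite lerDr.
Qed.

(* The function [min 1 |x| * |x| ^ - (q + h) * exp (2 k |ln |x||)]: its last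
   factor absorbs the logarithm that appears when the exponent [h] moves by at
   most [k]. *)
Definition envelope (q h k x : R) : R :=
  if `|x| <= 1 then `|x| `^ (1 - q - h - 2 * k) else `|x| `^ (- q - h + 2 * k).

Lemma envelope_ge0 q h k x : 0 <= envelope q h k x.
Proof. by rewrite /envelope; case: ifP => _; exact: powR_ge0. Qed.

Lemma powR_exp (y r : R) : 0 < y -> y `^ r = expR (r * ln y).
Proof. by move=> y0; rewrite /powR gt_eqF. Qed.

Lemma envelope_exp q h k x : x != 0 -> Num.min 1 `|x| *
  (expR (- (q + h) * ln `|x|) * expR (2 * k * `|ln `|x| |)) = envelope q h k x.
Proof.
move=> x0; have y0 : 0 < `|x| by rewrite normr_gt0.
rewrite /envelope; have [y1|y1] := leP `|x| 1.
  have l0 : ln `|x| <= 0 by exact: ln_le0.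
  rewrite -{1}(lnK y0) (ler0_norm l0) -!expRD powR_exp//.
  by congr expR; ring.
have l0 : 0 <= ln `|x| by rewrite ln_ge0// ltW.
rewrite mul1r (ger0_norm l0) -!expRD powR_exp//.
by congr expR; ring.
Qed.

(** Either sign reduces to 1 + y <= e^y, taken at y = -z when z >= 0 and at y = z when z < 0. *)
Lemma expR_sub1_le (z : R) : `|expR z - 1| <= `|z| * expR `|z|.
Proof.
have [z0|z0] := leP 0 z.
  have e1 : 1 <= expR z by rewrite -expR0 ler_expR.
  rewrite ger0_norm ?subr_ge0// ger0_norm//.
  have := expR_ge1Dx (- z); rewrite expRN => h.
  have := ler_wpM2l (expR_ge0 z) h; rewrite mulfV ?gt_eqF ?expR_gt0//.
  by lra.
have e1 : expR z <= 1 by rewrite -expR0 ler_expR ltW.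
rewrite ler0_norm ?subr_le0// ltr0_norm//.
have h1 : 1 <= expR (- z) by rewrite -expR0 ler_expR oppr_ge0 ltW.
by have := expR_ge1Dx z; nra.
Qed.

Lemma cmod_kern_le alpha h s x :
  cmod (kern alpha h s) x <= (2 + `|s|) * envelope alpha^-1 h 0 x.
Proof.
have [->|x0] := eqVneq x 0.
  rewrite /cmod kernE /= mulr0 cos0 sin0 subrr !mul0r expr0n /= addr0 sqrtr0.
  by rewrite mulr_ge0 ?envelope_ge0// addr_ge0.
have y0 : 0 < `|x| by rewrite normr_gt0.
rewrite -envelope_exp// mulr0 mul0r expR0 mulr1 mulrA.
rewrite /cmod kernE /= ![_ / _]mulrC sqrt_sum_scale -/(osc s x).
rewrite -powRN powR_exp// ger0_norm ?expR_ge0// mulrC.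
by apply: ler_wpM2r; [exact: expR_ge0|exact: osc_le].
Qed.

(** With l = ln |x|, the two powers of |x| differ by the factor e^{-(h'-h)l} - 1, which is at most
    |h'-h| |l| e^{k|l|} in modulus. The bound |l| <= e^{k|l|} / k then absorbs the logarithm: hence
    the division by [k], and [2 * k] in the envelope. *)
Lemma cmod_kern_diff_le alpha h h' k c s x : 0 < k -> `|h' - h| <= k ->
  cmod (lincomb c (- c) (kern alpha h' s) (kern alpha h s)) x <=
  (`|c| * (`|h' - h| / k) * (2 + `|s|)) * envelope alpha^-1 h k x.
Proof.
move=> k0 hk.
have [->|x0] := eqVneq x 0.
  rewrite /cmod /= !kernE /= mulr0 cos0 sin0 subrr !mul0r !mulr0 addr0 expr0n /=.
  rewrite addr0 sqrtr0 mulr_ge0 ?envelope_ge0// mulr_ge0 ?addr_ge0// mulr_ge0//.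
  by rewrite divr_ge0// ltW.
have y0 : 0 < `|x| by rewrite normr_gt0.
rewrite -envelope_exp// /cmod /= !kernE /=.
set q := alpha^-1; set l := ln `|x|.
rewrite -!powRN !powR_exp// -/l.
rewrite (_ : c * _ + _ = (c * (expR (- (q + h') * l) - expR (- (q + h) * l))) *
  (cos (s * x) - 1)); last by ring.
rewrite (_ : c * _ + _ = (c * (expR (- (q + h') * l) - expR (- (q + h) * l))) *
  sin (s * x)); last by ring.
rewrite sqrt_sum_scale -/(osc s x).
have E : `|expR (- (q + h') * l) - expR (- (q + h) * l)| <=
    expR (- (q + h) * l) * (`|h' - h| / k * expR (2 * k * `|l|)).
  rewrite (_ : - (q + h') * l = - (q + h) * l + (- (h' - h) * l)); last by ring.
  rewrite expRD -[X in _ - X]mulr1 -mulrBr normrM ger0_norm ?expR_ge0//.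
  apply: ler_wpM2l; first exact: expR_ge0.
  apply: le_trans (expR_sub1_le _) _; rewrite normrM normrN.
  have kl : k * `|l| <= expR (k * `|l|).
    by have := expR_ge1Dx (k * `|l|); lra.
  rewrite (_ : 2 * k * `|l| = k * `|l| + k * `|l|); last by ring.
  rewrite expRD mulrA; apply: ler_pM => //; rewrite ?mulr_ge0 ?expR_ge0//.
    rewrite -mulrA; apply: ler_wpM2l => //.
    by rewrite mulrC ler_pdivlMr// mulrC.
  by rewrite ler_expR ler_wpM2r.
rewrite normrM.
apply: (@le_trans _ _ (`|c| * (expR (- (q + h) * l) *
    (`|h' - h| / k * expR (2 * k * `|l|))) * ((2 + `|s|) * Num.min 1 `|x|))).
  apply: ler_pM; rewrite ?mulr_ge0 ?sqrtr_ge0 ?osc_le//.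
  exact: ler_wpM2l.
by rewrite le_eqVlt; apply/orP; left; apply/eqP; ring.
Qed.

(** The power [alpha] turns the 1/alpha of the kernel exponent into the 1 built into
    [two_powers]. *)
Lemma envelope_pow alpha h k x : 0 < alpha ->
  envelope alpha^-1 h k x `^ alpha =
  two_powers (alpha * (1 - h - 2 * k)) (alpha * (h - 2 * k)) x.
Proof.
move=> al0; have aln : alpha != 0 by rewrite gt_eqF.
by rewrite /envelope /two_powers; case: ifP => _; rewrite -powRrM;
  congr (_ `^ _); field.
Qed.

Lemma Lalpha_pow_envelope_le alpha h k c f : 0 < alpha -> 0 <= c ->
  measurable_fun [set: R] (fun x => (f x).1) ->
  measurable_fun [set: R] (fun x => (f x).2) ->
  (forall x, cmod f x <= c * envelope alpha^-1 h k x) ->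
  (Lalpha_pow alpha f <= (c `^ alpha)%:E *
    \int[mu]_x (two_powers (alpha * (1 - h - 2 * k)) (alpha * (h - 2 * k)) x)%:E)%E.
Proof.
move=> al0 c0 m1 m2 fc.
have mt := @measurable_two_powers R (alpha * (1 - h - 2 * k)) (alpha * (h - 2 * k)).
rewrite -ge0_integralZl_EFin ?powR_ge0//; last 2 first.
- by move=> x _; rewrite lee_fin two_powers_ge0.
- exact/measurable_EFinP.
apply: ge0_le_integral => //.
- by move=> x _; rewrite lee_fin powR_ge0.
- exact: measurable_cmod_pow.
- by apply: measurable_funeM; exact/measurable_EFinP.
move=> x _; rewrite -EFinM lee_fin -envelope_pow// -powRM ?envelope_ge0//.
by apply: ge0_ler_powR; rewrite ?nnegrE ?cmod_ge0 ?mulr_ge0 ?envelope_ge0// ltW.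
Qed.

Lemma admissible_kern alpha h s : 0 < alpha -> 0 < h -> h < 1 ->
  admissible alpha (kern alpha h s).
Proof.
move=> al0 h0 h1; have [m1 m2] := measurable_kern alpha h s.
split; [exact: kern_hermitian|exact: m1|exact: m2|].
have s0 : 0 <= 2 + `|s| by rewrite addr_ge0.
apply: le_lt_trans (Lalpha_pow_envelope_le al0 s0 m1 m2 (cmod_kern_le alpha h s)) _.
apply: lte_mul_pinfty; rewrite ?lee_fin ?powR_ge0//.
by apply: integral_two_powers_lty; rewrite mulr0 subr0 mulr_gt0// subr_gt0.
Qed.

Definition combination {n : nat} (v : 'I_n -> R) (F : 'I_n -> R -> R * R) :
    R -> R * R :=
  fun x => (\sum_i v i * (F i x).1, \sum_i v i * (F i x).2).

(* The increments differ from the kernels of the limit process by the dilation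
   of ratio [e] and the rotation of angle [t x]. *)
Lemma cmod_combination_kern n (v u : 'I_n -> R) alpha h t e x : 0 < e ->
  cmod (combination v (fun i => lincomb (e `^ (- h)) (- e `^ (- h))
    (kern alpha h (t + e * u i)) (kern alpha h t))) x =
  e `^ alpha^-1 * cmod (combination v (fun i => kern alpha h (u i))) (e * x).
Proof.
move=> e0; set q := alpha^-1.
pose w := (`|x| `^ (q + h))^-1.
(* p + i r is the common combination at [e * x], up to a power of [e]; the increments multiply it by
   e^{itx}, of modulus one. *)
pose p := \sum_i v i * ((cos (u i * (e * x)) - 1) * w).
pose r := \sum_i v i * (sin (u i * (e * x)) * w).
pose E := e `^ (- h); pose D := e `^ (- (q + h)).
have L1 : \sum_i v i * (lincomb E (- E) (kern alpha h (t + e * u i)) (kern alpha h t) x).1 =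
    E * (cos (t * x) * p - sin (t * x) * r).
  rewrite !mulr_sumr -sumrB mulr_sumr; apply: eq_bigr => i _.
  rewrite /= !kernE /= -/q -/w (_ : (t + e * u i) * x = t * x + u i * (e * x)); last by ring.
  by rewrite cosD; ring.
have L2 : \sum_i v i * (lincomb E (- E) (kern alpha h (t + e * u i)) (kern alpha h t) x).2 =
    E * (sin (t * x) * p + cos (t * x) * r).
  rewrite !mulr_sumr -big_split mulr_sumr; apply: eq_bigr => i _.
  rewrite /= !kernE /= -/q -/w (_ : (t + e * u i) * x = t * x + u i * (e * x)); last by ring.
  by rewrite sinD; ring.
have DE : (`|e * x| `^ (q + h))^-1 = D * w.
  by rewrite normrM (gtr0_norm e0) powRM// ?ltW// invfM -powRN.
have R1 : \sum_i v i * (kern alpha h (u i) (e * x)).1 = D * p.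
  by rewrite mulr_sumr; apply: eq_bigr => i _; rewrite kernE /= -/q DE; ring.
have R2 : \sum_i v i * (kern alpha h (u i) (e * x)).2 = D * r.
  by rewrite mulr_sumr; apply: eq_bigr => i _; rewrite kernE /= -/q DE; ring.
rewrite /cmod /combination -/E L1 L2 R1 R2 !sqrt_sum_scale mulrA.
(* The scale factors satisfy [E] = e^q [D] with q = 1/alpha. *)
rewrite !ger0_norm ?powR_ge0//; congr (_ * _).
  rewrite /E /D -powRD; last by rewrite (gt_eqF e0) implybT.
  by rewrite opprD addrA subrr add0r.
rewrite (_ : _ + _ = (cos (t * x) ^+ 2 + sin (t * x) ^+ 2) * (p ^+ 2 + r ^+ 2)); last by ring.
by rewrite cos2Dsin2 mul1r.
Qed.

(** The factor e^{1/alpha}, raised to the power [alpha], is exactly the Jacobian of the dilation. *)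
Lemma Lalpha_pow_combination_kern n (v u : 'I_n -> R) alpha h t e :
  0 < alpha -> 0 < e ->
  Lalpha_pow alpha (combination v (fun i => lincomb (e `^ (- h)) (- e `^ (- h))
    (kern alpha h (t + e * u i)) (kern alpha h t))) =
  Lalpha_pow alpha (combination v (fun i => kern alpha h (u i))).
Proof.
move=> al0 e0; rewrite /Lalpha_pow.
rewrite -[RHS](ge0_integral_dilation e0); last 2 first.
- apply: measurable_cmod_pow; apply: measurable_sum => i; apply: measurable_funM => //;
    by have [] := measurable_kern alpha h (u i).
- by move=> x; rewrite lee_fin powR_ge0.
apply: eq_integral => x _; rewrite cmod_combination_kern// -EFinM.
rewrite powRM ?powR_ge0 ?cmod_ge0//.
by rewrite -powRrM mulVf ?gt_eqF// powRr1// ltW.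
Qed.

End Kernels.

(** * Stable integrals *)

Section StableIntegral.
Context {R : realType} {d : measure_display} {Omega : measurableType d}.
Variables (P : probability Omega R) (alpha : R) (I : (R -> R * R) -> Omega -> R).
Hypotheses (al0 : 0 < alpha) (HI : SaS_integral alpha P I).

Let measurable_I f : admissible alpha f -> measurable_fun setT (I f).
Proof. by case: HI => + _ _; exact. Qed.

Lemma ae_eq_Rintegral (f g : Omega -> R) : measurable_fun setT f ->
  measurable_fun setT g -> {ae P, forall w, f w = g w} ->
  \int[P]_w f w = \int[P]_w g w.
Proof.
move=> mf mg fg; congr fine; apply: ae_eq_integral => //.
- exact/measurable_EFinP.
- exact/measurable_EFinP.
- by move: fg; apply: filterS => w -> _.
Qed.

Lemma admissible_zero : admissible alpha (fun=> (0, 0)).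
Proof.
split => //.
- by move=> x /=; rewrite oppr0.
- rewrite /Lalpha_pow (_ : (\int[_]_(x in _) _)%E = 0%E) ?ltry//.
  apply: integral0_eq => x _.
  by rewrite /cmod /= expr0n addr0 sqrtr0 powR0// gt_eqF.
Qed.

Lemma SaS_integral_zero : {ae P, forall w, I (fun=> (0, 0)) w = 0}.
Proof.
have [_ lin _] := HI.
have := lin _ _ 0 0 admissible_zero admissible_zero.
rewrite (_ : lincomb 0 0 _ _ = fun=> (0, 0)); last first.
  by apply/funext => x; rewrite /lincomb /= !mul0r addr0.
by apply: filterS => w ->; rewrite !mul0r addr0.
Qed.

Lemma SaS_integral_combination n (v : 'I_n -> R) (F : 'I_n -> R -> R * R) :
  (forall i, admissible alpha (F i)) ->
  admissible alpha (combination v F) /\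
  {ae P, forall w, I (combination v F) w = \sum_i v i * I (F i) w}.
Proof.
elim: n v F => [|n IH] v F aF.
  have -> : combination v F = fun=> (0, 0).
    by apply/funext => x; rewrite /combination !big_ord0.
  split; first exact: admissible_zero.
  by apply: filterS SaS_integral_zero => w ->; rewrite big_ord0.
have [a1 e1] := IH (v \o lift ord0) (F \o lift ord0) (fun i => aF _).
have -> : combination v F = lincomb (v ord0) 1 (F ord0)
    (combination (v \o lift ord0) (F \o lift ord0)).
  by apply/funext => x; rewrite /combination /lincomb /= !big_ord_recl !mul1r.
split; first by apply: admissible_lincomb; [exact: ltW|exact: aF|exact: a1].
have [_ lin _] := HI.
have := lin _ _ (v ord0) 1 (aF ord0) a1; move: e1; apply: filterS2 => w e1 ->.
by rewrite e1 mul1r big_ord_recl.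
Qed.

Lemma SaS_integral_char f (u : R) : admissible alpha f ->
  \int[P]_w cos (u * I f w) = expR (- (`|u| `^ alpha * fine (Lalpha_pow alpha f))) /\
  \int[P]_w sin (u * I f w) = 0.
Proof.
by move=> af; have [_ _ /(_ f af u)[c s]] := HI; rewrite /Rintegral c s.
Qed.

(** A linear combination of the coordinates is almost surely one stable integral, whose
    characteristic function sees its integrand only through the L^alpha norm. *)
Lemma SaS_integral_same_char n (F G : 'I_n -> R -> R * R) :
  (forall i, admissible alpha (F i)) -> (forall i, admissible alpha (G i)) ->
  (forall v, Lalpha_pow alpha (combination v F) = Lalpha_pow alpha (combination v G)) ->
  same_char_fun P (fun i => I (F i)) (fun i => I (G i)).
Proof.
move=> aF aG FG v.
have key (K : 'I_n -> R -> R * R) (trig : R -> R) : measurable_fun [set: R] trig ->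
    (forall i, admissible alpha (K i)) ->
    \int[P]_w trig (\sum_i v i * I (K i) w) = \int[P]_w trig (1 * I (combination v K) w).
  move=> mt aK; have [aC eC] := SaS_integral_combination v aK.
  apply: ae_eq_Rintegral.
  - apply: (measurableT_comp mt); apply: measurable_sum => i.
    by apply: measurable_funM; [exact: measurable_cst|exact/measurable_I/aK].
  - apply: (measurableT_comp mt).
    by apply: measurable_funM; [exact: measurable_cst|exact/measurable_I/aC].
  - by move: eC; apply: filterS => w ->; rewrite mul1r.
have [aCF _] := SaS_integral_combination v aF.
have [aCG _] := SaS_integral_combination v aG.
have [cF sF] := SaS_integral_char 1 aCF; have [cG sG] := SaS_integral_char 1 aCG.
have E := congr1 (fun L => expR (- (`|1| `^ alpha * fine L))) (FG v).
split.
  exact: etrans (etrans (key F cos measurable_cos aF) cF)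
    (etrans E (esym (etrans (key G cos measurable_cos aG) cG))).
exact: etrans (etrans (key F sin measurable_sin aF) sF)
  (esym (etrans (key G sin measurable_sin aG) sG)).
Qed.

(** Integrand of a reference variable of scale 1: the interval has length 1 and is symmetric, which
    makes the function hermitian. *)
Let unit_indic : R -> R * R := fun x => (\1_`[(- 2^-1)%R, 2^-1%R]%classic x, 0).

Let admissible_unit_indic : admissible alpha unit_indic /\
  Lalpha_pow alpha unit_indic = 1%E.
Proof.
have E : Lalpha_pow alpha unit_indic = 1%E.
  rewrite /Lalpha_pow.
  transitivity (\int[@lebesgue_measure R]_x (\1_`[(- 2^-1)%R, 2^-1%R]%classic x)%:E)%E.
    apply: eq_integral => x _; rewrite /cmod /= expr0n addr0 sqrtr_sqr.
    rewrite /indic; case: (x \in _) => /=; rewrite ?normr1 ?normr0 ?powR1//.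
    by rewrite powR0// gt_eqF.
  rewrite integral_indic// setIT.
  apply: etrans (lebesgue_measure_itv `[- 2^-1, 2^-1]) _; rewrite /= lte_fin.
  rewrite ifT; last by lra.
  by rewrite -EFinB; congr EFin; field.
split; last exact: E.
split.
- move=> x; rewrite /= oppr0; split => //.
  by rewrite !indicE; congr (_%:R); congr nat_of_bool; apply/idP/idP;
    rewrite !inE/= !in_itv/=; lra.
- exact: measurable_indic.
- exact: measurable_cst.
- by rewrite E ltry.
Qed.

(* A stable variable is equal in law to its scale times a fixed one. *)
Lemma SaS_integral_trunc_small (h e : R) : 0 < h -> 0 < e ->
  exists2 eta : R, 0 < eta & forall g, admissible alpha g ->
    (Lalpha_pow alpha g <= eta%:E)%E -> \int[P]_w trunc h (I g w) <= e.
Proof.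
move=> h0 e0; have [aS LS] := admissible_unit_indic.
set S := I unit_indic; have mS : measurable_fun setT S by exact/measurable_I/aS.
have [k kS] : exists k, \int[P]_w trunc k.+1%:R (S w) <= e.
  have /cvgrPdist_le/(_ _ e0)[k _ /(_ k (leqnn k))] := Rintegral_trunc_cvg0 P mS.
  by rewrite /= sub0r normrN => le; exists k; exact: le_trans (ler_norm _) le.
have hk0 : 0 < h / k.+1%:R by rewrite divr_gt0.
(* With this bound the scale [K] of [I g] is at most h / (k + 1), so [trunc h (K * S w)] is at most
   [trunc k.+1%:R (S w)], whose expectation was made small. *)
exists ((h / k.+1%:R) `^ alpha); first exact: powR_gt0.
move=> g ag Lg; apply: le_trans kS.
have [c [c0 cE fc]] : exists c, [/\ 0 <= c, c%:E = Lalpha_pow alpha g &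
    fine (Lalpha_pow alpha g) = c].
  have L0 : (0 <= Lalpha_pow alpha g)%E.
    by apply: integral_ge0 => x _; rewrite lee_fin powR_ge0.
  exists (fine (Lalpha_pow alpha g)); split; first exact: fine_ge0.
    by apply: fineK; rewrite ge0_fin_numE//; case: ag.
  exact: erefl.
have L1 : fine (Lalpha_pow alpha unit_indic) = 1 by rewrite LS.
pose K := c `^ alpha^-1.
have K0 : 0 <= K by exact: powR_ge0.
have KE : K `^ alpha = c by rewrite /K -powRrM mulVf ?gt_eqF// powRr1.
have Kh : K <= h / k.+1%:R.
  have : c `^ alpha^-1 <= ((h / k.+1%:R) `^ alpha) `^ alpha^-1.
    apply: ge0_ler_powR; rewrite ?nnegrE ?powR_ge0//.
      by rewrite invr_ge0 ltW.
    by rewrite -lee_fin cE.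
  by rewrite -powRrM mulfV ?gt_eqF// powRr1// ltW.
have chars : same_char_fun P (fun _ : 'I_1 => I g) (fun _ : 'I_1 => fun w => K * S w).
  move=> v.
  have F1 (trig : R -> R) (f : Omega -> R) :
      \int[P]_w trig (\sum_(i < 1) v i * f w) = \int[P]_w trig (v ord0 * f w).
    by apply: eq_Rintegral => w _; rewrite big_ord1.
  have F2 (trig : R -> R) :
      \int[P]_w trig (v ord0 * (K * S w)) = \int[P]_w trig (v ord0 * K * S w).
    by apply: eq_Rintegral => w _; rewrite mulrA.
  have [cg sg] := SaS_integral_char (v ord0) ag.
  rewrite fc in cg; have [cS sS] := SaS_integral_char (v ord0 * K) aS.
  have E : expR (- (`|v ord0 * K| `^ alpha * fine (Lalpha_pow alpha unit_indic))) =
      expR (- (`|v ord0| `^ alpha * c)).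
    by rewrite normrM (ger0_norm K0) (powRM alpha (normr_ge0 _) K0) KE L1 mulr1.
  split.
    exact: etrans (F1 cos (I g)) (etrans cg (esym
      (etrans (F1 cos (fun w => K * S w)) (etrans (F2 cos) (etrans cS E))))).
  exact: etrans (F1 sin (I g)) (etrans sg (esym
    (etrans (F1 sin (fun w => K * S w)) (etrans (F2 sin) sS)))).
have cphi : continuous (fun v : 'rV[R]_1 => trunc h (v ord0 ord0)).
  move=> v; apply: (@continuous_comp _ _ _ (fun v : 'rV[R]_1 => v ord0 ord0) (trunc h)).
    exact: coord_continuous.
  exact: continuous_trunc.
have mKS : measurable_fun setT (fun w => K * S w) by exact: measurable_funM.
have [_] := @same_char_fun_law _ _ _ _ P _ _ _ 1 (fun=> measurable_I ag) (fun=> mKS)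
  chars cphi (fun v => trunc_norm _ h0).
have E1 : \int[P]_w trunc h ((\row_(i < 1) I g w) ord0 ord0) = \int[P]_w trunc h (I g w).
  by apply: eq_Rintegral => w _; rewrite mxE.
have E2 : \int[P]_w trunc h ((\row_(i < 1) (K * S w)) ord0 ord0) =
    \int[P]_w trunc h (K * S w).
  by apply: eq_Rintegral => w _; rewrite mxE.
move=> E; apply: le_trans (_ : \int[P]_w trunc h (K * S w) <= _).
  by rewrite le_eqVlt; apply/orP; left; apply/eqP; exact: etrans (esym E1) (etrans E E2).
apply: le_Rintegral => //.
- apply: (@bounded_integrable _ _ _ _ _ 1); last by move=> w; exact: trunc_norm.
  exact: (measurableT_comp (measurable_trunc h)).
- apply: (@bounded_integrable _ _ _ _ _ 1); last by move=> w; exact: trunc_norm.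
  exact: (measurableT_comp (measurable_trunc _)).
move=> w _; rewrite /trunc le_min ge_min lexx /= ge_min; apply/orP; right.
rewrite normrM (ger0_norm K0) ler_pdivrMr// mulrAC ler_pdivlMr// mulrC mulrA.
by rewrite [leRHS]mulrC ler_wpM2r// mulrC -ler_pdivlMr.
Qed.

End StableIntegral.

(** * The error made by freezing the Hurst exponent *)

Section Remainder.
Context {R : realType}.

(** The Hölder bound gives |H s - h| of order e^gamma, so the kernel is at most a constant times
    e^{gamma - h} times a fixed envelope in L^alpha, and gamma > h. *)
Lemma kern_remainder_small (alpha C gamma t u : R) (H : R -> R) :
  0 < alpha -> 0 < H t -> H t < 1 -> H t < gamma -> 0 < C -> 0 <= t -> 0 <= u ->
  (forall s, 0 <= s -> `|H s - H t| <= C * `|s - t| `^ gamma) ->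
  forall eta : R, 0 < eta -> \forall e \near 0^'+,
  (Lalpha_pow alpha (lincomb (e `^ (- H t)) (- e `^ (- H t))
     (kern alpha (H (t + e * u)) (t + e * u)) (kern alpha (H t) (t + e * u)))%R
   <= eta%:E)%E.
Proof.
set h := H t => al0 h0 h1 hg C0 t0 u0 Hold eta eta0.
have g0 : 0 < gamma by exact: lt_trans hg.
(* A quarter of min(h, 1 - h) leaves both exponents of the envelope on the integrable side. *)
have [k k0 [hk h1k]] : exists2 k : R, 0 < k & 0 < h - 2 * k /\ 0 < 1 - h - 2 * k.
  have [hh|hh] := leP h (1 - h); [exists (h / 4)|exists ((1 - h) / 4)]; lra.
pose L := (\int[@lebesgue_measure R]_x
  (two_powers (alpha * (1 - h - 2 * k)) (alpha * (h - 2 * k)) x)%:E)%E.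
have Loo : (L < +oo)%E by apply: integral_two_powers_lty; exact: mulr_gt0.
have L0 : (0 <= L)%E.
  by apply: integral_ge0 => x _; rewrite lee_fin two_powers_ge0.
have LE : (L = (fine L)%:E)%E by rewrite fineK// ge0_fin_numE.
have l0 : 0 <= fine L by exact: fine_ge0.
pose D := C * u `^ gamma.
have D0 : 0 <= D by rewrite mulr_ge0 ?powR_ge0// ltW.
(* The sum [2 + t + u] bounds [2 + |s|] as soon as [e <= 1]. *)
pose B := D / k * (2 + t + u).
have B0 : 0 <= B by rewrite mulr_ge0 ?divr_ge0 ?addr_ge0// ltW.
have small (a b c : R) : 0 <= a -> 0 < b -> 0 < c ->
    (* The proof divides by [a + 1], since [a] may be 0. *)
    \forall e \near (0:R)^'+, a * e `^ b <= c.
  move=> a0 b0 c0; have a10 : 0 < c / (a + 1) by rewrite divr_gt0// ltr_wpDl.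
  have /cvgrPdist_le/(_ _ a10) := powR_cvg0 b0.
  apply: filterS => e; rewrite sub0r normrN ger0_norm ?powR_ge0// => he.
  apply: (@le_trans _ _ ((a + 1) * e `^ b)).
    by apply: ler_wpM2r; rewrite ?powR_ge0// lerDl.
  by rewrite mulrC -ler_pdivlMr// ltr_wpDl.
near=> e.
have e0 : 0 < e by near: e; exact: nbhs_right_gt.
have e1 : e <= 1 by near: e; exact: nbhs_right_le.
have Dk : D * e `^ gamma <= k by near: e; exact: small.
have Beta : (B `^ alpha * fine L) * e `^ ((gamma - h) * alpha) <= eta.
  near: e; apply: small => //; first by rewrite mulr_ge0 ?powR_ge0.
  by rewrite mulr_gt0// subr_gt0.
set s := t + e * u.
have s0 : 0 <= s by rewrite addr_ge0// mulr_ge0// ltW.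
have Hs : `|H s - h| <= D * e `^ gamma.
  apply: le_trans (Hold _ s0) _; rewrite /s addrC addKr.
  rewrite normrM (ger0_norm u0) (gtr0_norm e0) (powRM gamma (ltW e0) u0).
  by rewrite le_eqVlt; apply/orP; left; apply/eqP; rewrite /D; ring.
have [m1 m2] := measurable_kern alpha (H s) s.
have [n1 n2] := measurable_kern alpha h s.
pose c := `|e `^ (- h)| * (`|H s - h| / k) * (2 + `|s|).
have c0 : 0 <= c.
  by rewrite /c mulr_ge0 ?addr_ge0// mulr_ge0// divr_ge0// ltW.
have cB : c <= B * e `^ (gamma - h).
  rewrite /c ger0_norm ?powR_ge0// (ger0_norm s0).
  apply: (@le_trans _ _ (e `^ (- h) * (D * e `^ gamma / k) * (2 + t + u))).
    apply: ler_pM.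
    - apply: mulr_ge0; first exact: powR_ge0.
      by apply: divr_ge0; [exact: normr_ge0|exact: ltW].
    - exact: addr_ge0.
    - apply: ler_wpM2l; first exact: powR_ge0.
      by apply: ler_wpM2r => //; rewrite invr_ge0 ltW.
    - by rewrite /s -!addrA !lerD2l ler_piMl.
  rewrite (_ : gamma - h = - h + gamma); last by rewrite addrC.
  rewrite powRD; last by rewrite (gt_eqF e0) implybT.
  by rewrite le_eqVlt; apply/orP; left; apply/eqP; rewrite /B; ring.
apply: le_trans (Lalpha_pow_envelope_le (h := h) (k := k) al0 c0 _ _ _) _.
- by apply: measurable_funD; exact: measurable_funM.
- by apply: measurable_funD; exact: measurable_funM.
- by move=> x; apply: cmod_kern_diff_le => //; exact: le_trans Dk.
rewrite -/L LE -EFinM lee_fin; apply: le_trans Beta.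
apply: (@le_trans _ _ ((B * e `^ (gamma - h)) `^ alpha * fine L)).
  apply: ler_wpM2r => //; apply: ge0_ler_powR => //; rewrite ?nnegrE ?(ltW al0)//.
  by rewrite mulr_ge0// powR_ge0.
by rewrite powRM ?powR_ge0// -powRrM mulrAC.
Unshelve. all: by end_near. Qed.

End Remainder.

(** * Localizability of the process *)

Unset Implicit Arguments.

Theorem mainTheorem5 (R : realType) (alpha : R) (H : R -> R)
  (d : measure_display) (Omega : measurableType d) (P : probability Omega R)
  (I : (R -> R * R) -> Omega -> R) :
  1 < alpha -> alpha < 2 ->
  (exists hl : R, 0 < hl /\ forall t, 0 <= t -> hl <= H t) ->
  (exists hu : R, hu < 1 /\ forall t, 0 <= t -> H t <= hu) ->
  (exists C gamma hu : R, [/\ 0 < C, hu < gamma,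
      (forall t, 0 <= t -> H t <= hu) &
      forall t s, 0 <= t -> 0 <= s -> `|H t - H s| <= C * `|t - s| `^ gamma]) ->
  SaS_integral alpha P I ->
  forall t : R, 0 <= t ->
    localizable_at P (rhmsp alpha H I) (H t) t (Zproc alpha (H t) I).
Proof.
move=> al1 _ [hl [hl0 Hl]] [hu [hu1 Hu]] [C [gamma [hu' [C0 hug Hu' Hold]]]] HI t t0.
have al0 : 0 < alpha by exact: lt_trans al1.
have H01 s : 0 <= s -> 0 < H s < 1.
  by move=> s0; rewrite (lt_le_trans hl0 (Hl _ s0)) (le_lt_trans (Hu _ s0)).
have Hg : H t < gamma by exact: le_lt_trans (Hu' _ t0) hug.
set h := H t; have /andP[h0 h1] := H01 _ t0.
have mI f : admissible alpha f -> measurable_fun setT (I f).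
  by case: HI => + _ _; exact.
have lin f g a b : admissible alpha f -> admissible alpha g ->
    {ae P, forall w, I (lincomb a b f g) w = a * I f w + b * I g w}.
  by case: HI => _ + _; exact.
move=> n us us0 phi cphi [M phiM].
have aK s := admissible_kern s al0 h0 h1.
have aZ i := aK (us i).
have aX s : 0 <= s -> admissible alpha (kern alpha (H s) s).
  by move=> /H01/andP[Hs0 Hs1]; exact: admissible_kern.
pose Y e i w := e `^ (- h) * (rhmsp alpha H I (t + e * us i) w - rhmsp alpha H I t w).
pose a e i := lincomb (e `^ (- h)) (- e `^ (- h))
  (kern alpha h (t + e * us i)) (kern alpha h t).
pose g e i := lincomb (e `^ (- h)) (- e `^ (- h))
  (kern alpha (H (t + e * us i)) (t + e * us i)) (kern alpha h (t + e * us i)).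
(* The Hurst function is controlled at nonnegative times only, so every fact about [g] and [Y] is
   restricted to [0 < e]. *)
have s0 e i : 0 < e -> 0 <= t + e * us i by move=> /ltW e0; rewrite addr_ge0// mulr_ge0.
have mY e : 0 < e -> forall i, measurable_fun setT (Y e i).
  move=> e0 i; apply: measurable_funM => //.
  by apply: measurable_funB; apply/mI/aX; [exact: s0|exact: t0].
have aa e i : admissible alpha (a e i).
  by apply: admissible_lincomb; [exact: ltW|exact: aK|exact: aK].
have ag e i : 0 < e -> admissible alpha (g e i).
  by move=> e0; apply: admissible_lincomb; [exact: ltW|exact/aX/s0|exact: aK].
have mZ i : measurable_fun setT (I (kern alpha h (us i))) by exact/mI/aZ.
have mphiZ : measurable_fun setT (fun w => phi (\row_i I (kern alpha h (us i)) w)).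
  by have [] := @same_char_fun_law _ _ _ _ P _ _ phi M mZ mZ (fun v => conj erefl erefl) cphi phiM.
rewrite (bounded_integralE P mphiZ (fun w => phiM _)).
(* The expectations are finite for [0 < e], so the limit can be taken among the reals. *)
apply: cvg_EFin.
  near=> e; have e0 : 0 < e by near: e; exact: nbhs_right_gt.
  have mphiY : measurable_fun setT (fun w => phi (\row_i Y e i w)).
    by have [] := @same_char_fun_law _ _ _ _ P _ _ phi M (mY _ e0) (mY _ e0)
      (fun v => conj erefl erefl) cphi phiM.
  by rewrite (bounded_integralE P mphiY (fun w => phiM _)).
apply: (@slutsky _ _ _ _ P _ _ _ Y (fun e i => I (a e i)) _ phi M) => //.
- near=> e; have e0 : 0 < e by near: e; exact: nbhs_right_gt.
  split; [exact: mY|by move=> i; exact/mI/aa|].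
  apply: SaS_integral_same_char; [exact: al0|exact: HI|exact: aa|exact: aZ|move=> v].
  exact: Lalpha_pow_combination_kern.
move=> i r r0; apply/cvgrPdist_le => /= eps eps0.
have [eta eta0 small] := SaS_integral_trunc_small al0 HI r0 eps0.
have rem := kern_remainder_small al0 h0 h1 Hg C0 t0 (us0 i)
  (fun s s0 => Hold s t s0 t0) eta0.
near=> e; have e0 : 0 < e by near: e; exact: nbhs_right_gt.
have mYA : measurable_fun setT (fun w => Y e i w - I (a e i) w).
  by apply: measurable_funB; [exact: mY|exact/mI/aa].
rewrite sub0r normrN ger0_norm; last first.
  by apply: Rintegral_ge0 => w _; exact: trunc_ge0.
(* By almost sure linearity, [Y e i] minus [I (a e i)] is the single stable integral [I (g e i)], of
   small norm by [rem]. *)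
rewrite (@ae_eq_Rintegral _ _ _ P _ (fun w => trunc r (I (g e i) w))).
- by apply: small; [exact: ag|near: e; exact: rem].
- exact: (measurableT_comp (measurable_trunc r)).
- by apply: (measurableT_comp (measurable_trunc r)); apply: mI; exact: ag.
have la := lin _ _ (e `^ (- h)) (- e `^ (- h)) (aK (t + e * us i)) (aK t).
have lg := lin _ _ (e `^ (- h)) (- e `^ (- h)) (aX _ (s0 _ i e0)) (aK (t + e * us i)).
move: la lg; apply: filterS2 => w la lg; congr trunc.
by rewrite la lg /Y /rhmsp -/h; ring.
Unshelve. all: by end_near. Qed.
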